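(* Let $X\subseteq\mathbb{P}^r$ be a quasi-projective variety of dimension $n\ge 1$. The sequence $\{\mathfrak{c}_1,\mathfrak{c}_2,\dots\}$ of ranks of the sheaves $R_i$ is strictly decreasing to a stable number, i.e. there is $m\ge 1$ with $\mathfrak{c}_1>\mathfrak{c}_2>\dots>\mathfrak{c}_m=\mathfrak{c}_{m+1}=\dots$, such that (1) either $\mathfrak{c}_m=0$, $R_m=0$, and $X$ is not contained in any proper linear subspace of $\mathbb{P}^r$; or (2) there exists a subspace $W\subseteq V$ of dimension $\mathfrak{c}_m$ such that $R_m\otimes L=W\otimes\mathcal{O}_X$, this sheaf is contained in $R_i\otimes L$ for all $i\ge 0$, and $X$ is contained in the linear space $\mathbb{P}(V/W)\subseteq\mathbb{P}^r$.
   Context: Work over $\mathbb{C}$; a variety is separated, reduced, irreducible, of finite type over $\mathbb{C}$. Let $L=\mathcal{O}_X(1)$, $V=H^0(\mathbb{P}^r,\mathcal{O}_{\mathbb{P}^r}(1))$; $\mathbb{P}(V)=\mathbb{P}^r$ denotes the space of one-dimensional quotients, so $\mathbb{P}(V/W)$ is the linear subspace cut out by the linear forms in $W$. For $k\ge 0$ let $P^k(L)=pr_{1,*}\big((\mathcal{O}_{X\times X}/I_\Delta^{k+1})\otimes pr_2^*L\big)$ be the sheaf of $k$-th order principal parts ($\mathcal{O}_X$-module via $pr_1$), with universal differential operator $d^k_L:L\to P^k(L)$ induced by $pr_2$. The Taylor series map is the $\mathcal{O}_X$-linear map $\alpha_k:V\otimes\mathcal{O}_X\to P^k(L)$, $T\otimes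 a\mapsto a\,d^k_L(T|_X)$. Put $R_k=(\ker\alpha_k)\otimes L^*$ and $\mathfrak{c}_k=\operatorname{rank}R_k$ (so $R_k\otimes L=\ker\alpha_k\subseteq V\otimes\mathcal{O}_X$). *)

(* Defs.v *)
From mathcomp Require Import all_boot all_order all_algebra.
From mathcomp Require Import boolp classical_sets reals.
From mathcomp Require Import complex.
From mathcomp Require Import mpoly.

Set Implicit Arguments.
Unset Strict Implicit.
Unset Printing Implicit Defensive.

Import GRing.Theory.
Local Open Scope ring_scope.
Local Open Scope classical_set_scope.

Section PrincipalParts.
Context {R : realType} {r : nat}.

Notation C := R[i].

(* Homogeneous coordinate vectors of points of P^r = P(V), i.e. elements of
   the dual of V.  A subset of P^r is represented by the set of all (nonzero)
   homogeneous coordinate vectors of its points, i.e. by its punctured affine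
   cone; a subset of P^r x P^r is represented by a set of pairs of vectors. *)
Notation pt := 'rV[C]_r.+1.

(* V = H^0(P^r, O(1)), in coordinates with respect to the basis T_0, ..., T_r
   of homogeneous coordinate functions. *)
Notation V := 'rV[C]_r.+1.

Definition Pr : set pt := [set x : pt | x != 0].

(* ** Zariski topology *)

Definition homogs (S : set {mpoly C[r.+1]}) : Prop :=
  forall f, S f -> exists d : nat, f \is d.-homog.

Definition zeros (S : set {mpoly C[r.+1]}) : set pt :=
  [set x : pt | x != 0 /\ forall f, S f -> f.@[x 0] = 0].

Definition zclosed (Y Z : set pt) : Prop :=
  exists2 S, homogs S & Z = Y `&` zeros S.

Definition zopen (Y U : set pt) : Prop :=
  exists2 Z, zclosed Y Z & U = Y `\` Z.

Definition zirreducible (Z : set pt) : Prop :=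
  Z !=set0 /\
  forall A B, zclosed Z A -> zclosed Z B -> Z = A `|` B -> Z = A \/ Z = B.

(* Quasi-projective varieties X in P^r, through their closed points. *)
Definition qproj_variety (X : set pt) : Prop :=
  (exists A B, [/\ zclosed Pr A, zopen Pr B & X = A `&` B]) /\
  zirreducible X.

Definition has_chain (X : set pt) (n : nat) : Prop :=
  exists Z : nat -> set pt,
    (forall i, (i <= n)%N -> zclosed X (Z i) /\ zirreducible (Z i)) /\
    (forall i, (i < n)%N -> Z i `<` Z i.+1).

Definition has_dim (X : set pt) (n : nat) : Prop :=
  has_chain X n /\ forall l, has_chain X l -> (l <= n)%N.

(* The form T_w = \sum_i w_i T_i associated with w in V. *)
Definition lform (w : V) (x : pt) : C := \sum_i w 0 i * x 0 i.

(* P(V/W), as a subset of P^r = P(V). *)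
Definition linspace (W : {vspace V}) : set pt :=
  [set x : pt | x != 0 /\ forall w, w \in W -> lform w x = 0].

(* ** The line bundles O_X(d) *)

(* Sections of O_X(d) over U, as functions on the cone over U which are
   locally of the form F/G with F, G homogeneous and deg F - deg G = d.
   O_X, L and L^* are the cases d = 0, 1, -1.  Two functions which agree on U
   represent the same section. *)
Definition sec (X : set pt) (d : int) (U : set pt) (f : pt -> C) : Prop :=
  forall x, U x -> exists U', [/\ zopen X U', U' x, U' `<=` U &
    exists (p q : nat) (F G : {mpoly C[r.+1]}),
      [/\ F \is p.-homog, G \is q.-homog, p%:Z - q%:Z = d &
          forall y, U' y -> G.@[y 0] != 0 /\ f y = F.@[y 0] / G.@[y 0]]].

(* Subsheaves of V (x) O_X(d): the sections over U are given by their
   coordinate vectors. *)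
Definition subsheaf := set pt -> set (pt -> V).

Definition VO (X : set pt) : subsheaf := fun U =>
  [set a | forall i, sec X 0 U (fun x => a x 0 i)].

(* W (x) O_X as a subsheaf of V (x) O_X. *)
Definition WO (X : set pt) (W : {vspace V}) : subsheaf := fun U =>
  [set s | exists (N : nat) (w : 'I_N -> V) (f : 'I_N -> pt -> C),
     [/\ forall j, w j \in W, forall j, sec X 0 U (f j) &
         forall x, U x -> s x = \sum_j f j x *: w j]].

(* F (x) O_X(e): since O_X(e) is invertible, for F a subsheaf of V (x) O_X(d)
   this is the image of the multiplication F (x) O_X(e) -> V (x) O_X(d+e). *)
Definition twist (X : set pt) (F : subsheaf) (e : int) : subsheaf := fun U =>
  [set s | forall x, U x -> exists U', [/\ zopen X U', U' x, U' `<=` U &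
    exists (N : nat) (t : 'I_N -> pt -> C) (f : 'I_N -> pt -> V),
      [/\ forall j, sec X e U' (t j), forall j, F U' (f j) &
          forall y, U' y -> s y = \sum_j t j y *: f j y]]].

Definition zero_sheaf (X : set pt) (F : subsheaf) : Prop :=
  forall U s, zopen X U -> F U s -> forall x, U x -> s x = 0.

(* c is the dimension of the stalk of F at the generic point over the function
   field K(X): the germs of s_1, ..., s_c at the generic point form a K(X)-basis
   (elements of K(X) and of the generic stalk are represented by sections over
   nonempty open subsets). *)
Definition has_rank (X : set pt) (F : subsheaf) (c : nat) : Prop :=
  exists (U : set pt) (s : 'I_c -> pt -> V),
  [/\ zopen X U /\ U !=set0,
      forall j, F U (s j),
      forall U' (a : 'I_c -> pt -> C), zopen X U' -> U' !=set0 -> U' `<=` U ->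
        (forall j, sec X 0 U' (a j)) ->
        (forall x, U' x -> \sum_j a j x *: s j x = 0) ->
        forall j x, U' x -> a j x = 0 &
      forall U' t, zopen X U' -> U' !=set0 -> F U' t ->
        exists U'' (a : 'I_c -> pt -> C),
        [/\ zopen X U'' /\ U'' !=set0, U'' `<=` U `&` U',
            forall j, sec X 0 U'' (a j) &
            forall x, U'' x -> t x = \sum_j a j x *: s j x]].

(* ** The product X x X *)

Definition bieval (p : {mpoly C[r.+1 + r.+1]}) (z : pt * pt) : C :=
  p.@[row_mx z.1 z.2 0].

Definition bihomog (a b : nat) (p : {mpoly C[r.+1 + r.+1]}) : Prop :=
  forall m, m \in msupp p ->
    (\sum_(i < r.+1) m (lshift r.+1 i))%N = a /\
    (\sum_(i < r.+1) m (rshift r.+1 i))%N = b.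

Definition zopen2 (X : set pt) (W : set (pt * pt)) : Prop :=
  exists2 S : set {mpoly C[r.+1 + r.+1]},
    (forall f, S f -> exists a b, bihomog a b f) &
    W = [set z : pt * pt | [/\ X z.1, X z.2 & exists2 f, S f & bieval f z != 0]].

(* Sections of O_{X x X}(d, e) over W. *)
Definition sec2 (X : set pt) (d e : int) (W : set (pt * pt))
    (f : pt * pt -> C) : Prop :=
  forall z, W z -> exists W', [/\ zopen2 X W', W' z, W' `<=` W &
    exists (p q p' q' : nat) (F G : {mpoly C[r.+1 + r.+1]}),
      [/\ bihomog p q F, bihomog p' q' G,
          p%:Z - p'%:Z = d, q%:Z - q'%:Z = e &
          forall w, W' w -> bieval G w != 0 /\ f w = bieval F w / bieval G w]].

Definition diag_ideal (X : set pt) (W : set (pt * pt)) (g : pt * pt -> C) : Prop :=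
  sec2 X 0 0 W g /\ forall x, W (x, x) -> g (x, x) = 0.

(* ** Principal parts *)

(* h is, over W, a finite sum of products g_0 ... g_k l, with the g_i in the
   ideal of the diagonal and l a section of pr_2^* L. *)
Definition diag_pow (X : set pt) (k : nat) (W : set (pt * pt))
    (h : pt * pt -> C) : Prop :=
  exists (N : nat) (g : 'I_N -> 'I_k.+1 -> pt * pt -> C)
         (l : 'I_N -> pt * pt -> C),
    [/\ forall j i, diag_ideal X W (g j i),
        forall j, sec2 X 0 1 W (l j) &
        forall w, W w -> h w = \sum_j (\prod_i g j i w) * l j w].

(* A section of (O_{X x X} / I_Delta^{k+1}) (x) pr_2^* L
   = pr_2^* L / I_Delta^{k+1} pr_2^* L is a function assigning to each point z
   an element of the stalk at z, i.e. a coset, represented by the set of the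
   local sections of pr_2^* L near z that belong to it. *)
Definition ppfun := pt * pt -> set (pt * pt -> C).

Definition pp_class (X : set pt) (k : nat) (m : pt * pt -> C) : ppfun :=
  fun z => [set m' | exists W, [/\ zopen2 X W, W z, sec2 X 0 1 W m' &
                       diag_pow X k W (fun w => m' w - m w)]].

(* P^k(L)(U): sections over pr_1^-1(U) = U x X of the quotient sheaf. For a in
   VO X U, the function [taylor X k a] below belongs to this set. *)
Definition principal_parts (X : set pt) (k : nat) (U : set pt) : set ppfun :=
  [set s | forall z, U z.1 -> X z.2 ->
     exists W m, [/\ zopen2 X W, W z, (forall w, W w -> U w.1), sec2 X 0 1 W m &
                     forall w, W w -> s w = pp_class X k m w]].

Definition pp_zero (X : set pt) (k : nat) : ppfun := pp_class X k (fun=> 0).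

Definition pp_add (s t : ppfun) : ppfun := fun z =>
  [set m | exists m1 m2, [/\ s z m1, t z m2 & m = (fun w => m1 w + m2 w)]].

(* The O_X-module structure via pr_1. *)
Definition pp_scale (X : set pt) (k : nat) (a : pt -> C) (s : ppfun) : ppfun :=
  fun z => [set m | exists2 m0, s z m0 &
                      pp_class X k (fun w => a w.1 * m0 w) z m].

(* d^k_L t, for t a section of L over X. *)
Definition dk (X : set pt) (k : nat) (t : pt -> C) : ppfun :=
  pp_class X k (fun w => t w.2).

(* The Taylor series map alpha_k on \sum_i T_i (x) a_i. *)
Definition taylor (X : set pt) (k : nat) (a : pt -> V) : ppfun :=
  \big[pp_add/pp_zero X k]_(i < r.+1)
     pp_scale X k (fun x => a x 0 i) (dk X k (lform (delta_mx 0 i))).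

Definition ker_taylor (X : set pt) (k : nat) : subsheaf := fun U =>
  [set a | VO X U a /\
     forall z, U z.1 -> X z.2 -> taylor X k a z = pp_zero X k z].

Definition Rsheaf (X : set pt) (k : nat) : subsheaf :=
  twist X (ker_taylor X k) (-1).

End PrincipalParts.

(* Main.v *)
(** Let [E_k] be the stalk of [ker alpha_k] at the generic point, a subspace of
    [K^(r+1)], where [K] is the function field of [X].  The section
    [sum_i T_i (x) a_i] lies in [ker alpha_k] if and only if
    [h(x, y) = sum_i a_i(x) y_i] lies locally in [I_Delta^(k+1) pr_2^* L].
    A [C]-derivation [D] of [K], applied to the first factor of [X x X], maps
    [I_Delta^(k+2)] into [I_Delta^(k+1)] and [h] to [sum_i (D a_i)(x) y_i];
    hence [D E_(k+1)] is contained in [E_k].  If [E_(k+1) = E_k], this space is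
    stable under all derivations, so they annihilate the entries of a basis
    that contains an identity matrix, and in characteristic 0 these entries
    are in [C].  Thus [E_k = W (x) K] with [W] in [V]; restriction to the
    diagonal shows that the forms in [W] vanish on [X], so [W (x) O_X] is
    contained in all the [ker alpha_i], and the sequence is constant from [k]
    on.  As [W = 0] is allowed, alternative (2) always holds. *)

From HB Require Import structures.
Require Import Defs.
From mathcomp Require Import all_boot all_order all_algebra.
From mathcomp Require Import boolp classical_sets reals.
From mathcomp Require Import complex.
From mathcomp Require Import mpoly.
From mathcomp Require Import zify ring.

Set Implicit Arguments.
Unset Strict Implicit.
Unset Printing Implicit Defensive.

Import GRing.Theory.
Local Open Scope ring_scope.
Local Open Scope classical_set_scope.

(** * Extension of derivations *)

Section DerivationExtension.
Variables (k : closedFieldType) (K : fieldType) (iota : {rmorphism k -> K}).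
Hypothesis char0 : [pchar K] =i pred0.

(* The graph of a derivation over k from a subfield of K to K. *)
Record dgraph (G : K -> K -> Prop) : Prop := DGraph {
  dgC : forall c, G (iota c) 0;
  dgD : forall a a' b b', G a a' -> G b b' -> G (a + b) (a' + b');
  dgM : forall a a' b b', G a a' -> G b b' -> G (a * b) (a' * b + a * b');
  dgV : forall a a', G a a' -> G a^-1 (- a' / a ^+ 2);
  dg0 : forall a', G 0 a' -> a' = 0 }.

Section Graph.
Variables (G : K -> K -> Prop) (dG : dgraph G).

Lemma dg00 : G 0 0.
Proof. by have := dgC dG 0; rewrite rmorph0. Qed.

Lemma dgN a a' : G a a' -> G (- a) (- a').
Proof.
move=> Ga; have := dgM dG (dgC dG (-1)) Ga.
by rewrite rmorphN1 mul0r add0r !mulN1r.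
Qed.

Lemma dg_uniq a a1 a2 : G a a1 -> G a a2 -> a1 = a2.
Proof.
move=> h1 h2; apply/eqP; rewrite -subr_eq0; apply/eqP/(dg0 dG).
by rewrite -(subrr a); apply: (dgD dG) => //; apply: dgN.
Qed.

Lemma dg_sum (I : Type) (s : seq I) (F F' : I -> K) :
  (forall i, G (F i) (F' i)) -> G (\sum_(i <- s) F i) (\sum_(i <- s) F' i).
Proof.
move=> h; elim: s => [|i s IH]; first by rewrite !big_nil; apply: dg00.
by rewrite !big_cons; apply: (dgD dG).
Qed.

Definition polypair (p p' : {poly K}) := forall i, G p`_i p'`_i.

Lemma ppD p p' q q' :
  polypair p p' -> polypair q q' -> polypair (p + q) (p' + q').
Proof. by move=> h h' i; rewrite !coefD; apply: (dgD dG). Qed.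

Lemma ppN p p' : polypair p p' -> polypair (- p) (- p').
Proof. by move=> h i; rewrite !coefN; apply: dgN. Qed.

Lemma ppM p p' q q' :
  polypair p p' -> polypair q q' -> polypair (p * q) (p' * q + p * q').
Proof.
move=> h h' i; rewrite coefD !coefM -big_split /=.
by apply: dg_sum => j; apply: (dgM dG).
Qed.

Lemma ppC a a' : G a a' -> polypair a%:P a'%:P.
Proof. by move=> h i; rewrite !coefC; case: eqP => // _; apply: dg00. Qed.

Lemma ppX : polypair 'X 0.
Proof.
move=> i; rewrite coefX coef0.
by case: eqP => _ /=; [rewrite -(rmorph1 iota); apply: (dgC dG) | apply: dg00].
Qed.

Lemma ppXn n : polypair 'X^n 0.
Proof.
move=> i; rewrite coefXn coef0.
by case: eqP => _ /=; [rewrite -(rmorph1 iota); apply: (dgC dG) | apply: dg00].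
Qed.

Lemma pp_deriv p p' : polypair p p' -> polypair p^`() p'^`().
Proof.
move=> h i; rewrite !coef_deriv -[p`_i.+1 *+ _]mulr_natr -[p'`_i.+1 *+ _]mulr_natr.
have := dgM dG (h i.+1) (dgC dG (i.+1)%:R).
by rewrite mulr0 addr0 rmorph_nat.
Qed.

Lemma pp0 p' : polypair 0 p' -> p' = 0.
Proof.
by move=> h; apply/polyP => i; have := h i; rewrite coef0 => /(dg0 dG).
Qed.

(* The derivative of p(x), when x has derivative v and the coefficients of p
   have those of p' as derivatives. *)
Definition dval (x v : K) (p p' : {poly K}) := p'.[x] + p^`().[x] * v.

Definition consistent (x v : K) :=
  forall p p', polypair p p' -> p.[x] = 0 -> dval x v p p' = 0.

Definition dgext (x v : K) (c c' : K) :=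
  exists p p' q q', [/\ polypair p p', polypair q q', q.[x] != 0,
    c = p.[x] / q.[x] &
    c' = (dval x v p p' * q.[x] - p.[x] * dval x v q q') / q.[x] ^+ 2].

Lemma dgext_graph x v : consistent x v -> dgraph (dgext x v).
Proof.
move=> cons; have one : polypair 1 0.
  by have := ppC (dgC dG 1); rewrite rmorph1.
have null : polypair 0 0 by rewrite -[0]polyC0; apply/ppC/dg00.
split.
- move=> c; exists (iota c)%:P, 0, 1, 0; split=> //.
  + by rewrite -polyC0; apply: ppC; apply: (dgC dG).
  + by rewrite hornerE oner_neq0.
  + by rewrite !hornerE divr1.
  + by rewrite /dval -polyC1 !derivC !hornerE !(mul0r, mulr0, addr0, oppr0, subr0, divr1, expr1n).
- move=> a a' b b' [p [p' [q [q' [hp hq nq -> ->]]]]].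
  move=> [s [s' [t [t' [hs ht nt -> ->]]]]].
  exists (p * t + s * q), ((p' * t + p * t') + (s' * q + s * q')).
  exists (q * t), (q' * t + q * t').
  split; first by apply: ppD; apply: ppM.
  + exact: ppM.
  + by rewrite hornerM mulf_neq0.
  + by rewrite !(hornerD, hornerM); field; rewrite nt nq.
  + by rewrite /dval !derivE !(hornerD, hornerM); field; rewrite nt nq.
- move=> a a' b b' [p [p' [q [q' [hp hq nq -> ->]]]]].
  move=> [s [s' [t [t' [hs ht nt -> ->]]]]].
  exists (p * s), (p' * s + p * s').
  exists (q * t), (q' * t + q * t').
  split; first by apply: ppM.
  + exact: ppM.
  + by rewrite hornerM mulf_neq0.
  + by rewrite !(hornerD, hornerM); field; rewrite nt nq.
  + by rewrite /dval !derivE !(hornerD, hornerM); field; rewrite nt nq.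
- move=> a a' [p [p' [q [q' [hp hq nq -> ->]]]]].
  have [p0|np] := eqVneq p.[x] 0.
    exists 0, 0, 1, 0; rewrite hornerE oner_neq0 p0 !mul0r !invr0 horner0.
    split=> //; first by rewrite mul0r.
    by rewrite expr0n invr0 mulr0 /dval !derivE !(horner0, hornerC, hornerE) !(mul0r, mulr0, addr0, subr0, oppr0).
  by exists q, q', p, p'; split=> //; [field; rewrite nq np|field; rewrite nq np].
- move=> c' [p [p' [q [q' [hp hq nq /esym/eqP]]]]].
  rewrite mulf_eq0 invr_eq0 (negPf nq) orbF => /eqP px ->.
  by rewrite (cons _ _ hp px) px !mul0r subr0 mul0r.
Qed.

Lemma dgext_sub x v a a' : G a a' -> dgext x v a a'.
Proof.
move=> Ga; exists a%:P, a'%:P, 1, 0; split.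
- exact: ppC.
- by have := ppC (dgC dG 1); rewrite rmorph1.
- by rewrite hornerE oner_neq0.
- by rewrite !hornerE divr1.
- by rewrite /dval -polyC1 !derivC !hornerE !(mul0r, mulr0, addr0, oppr0, subr0, divr1, expr1n).
Qed.

Lemma dgext_gen x v : dgext x v x v.
Proof.
exists 'X, 0, 1, 0; split.
- exact: ppX.
- by have := ppC (dgC dG 1); rewrite rmorph1.
- by rewrite hornerE oner_neq0.
- by rewrite !hornerE divr1.
- by rewrite /dval !derivE !(horner0, hornerC, hornerE) /= mulr0 mul0r subr0 expr1n divr1.
Qed.

Lemma consistent_transc x v :
  (forall p p', polypair p p' -> p.[x] = 0 -> p = 0) -> consistent x v.
Proof.
move=> h p p' hp /(h _ _ hp) p0; move: hp; rewrite p0 => /pp0 ->.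
by rewrite /dval deriv0 !horner0 mul0r addr0.
Qed.

Lemma consistent_alg x m m' : polypair m m' -> m.[x] = 0 -> m != 0 ->
  (forall p p', polypair p p' -> p.[x] = 0 -> p != 0 -> (size m <= size p)%N) ->
  exists v, consistent x v.
Proof.
move=> hm mx m0 mmin.
have dm : m^`().[x] != 0.
  apply/eqP => /(mmin _ _ (pp_deriv hm)) hle.
  have /eqP dm0 : m^`() == 0.
    by apply: contraTT (lt_size_deriv m0) => /hle; rewrite -leqNgt.
  have : (size m <= 1)%N.
    rewrite leqNgt; apply/negP => sm.
    have := congr1 (fun q : {poly K} => q`_(size m).-2) dm0.
    rewrite coef_deriv coef0 -[X in m`_X]/((size m).-2.+1).
    have -> : (size m).-2.+1 = (size m).-1 by case: (size m) sm => [|[]].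
    move/eqP; rewrite -mulr_natr mulf_eq0 -lead_coefE lead_coef_eq0 (negPf m0).
    by move/pcharf0P: char0 => ->; case: (size m) sm => [|[]].
  move=> /size1_polyC mC; move: mx m0; rewrite mC hornerC => ->.
  by rewrite eqxx.
(* v is obtained by differentiating m(x) = 0. *)
exists (- m'.[x] / m^`().[x]); set v := (X in consistent _ X).
have vm : dval x v m m' = 0 by rewrite /dval /v; field.
move=> p; have [n] := ubnP (size p); elim: n p => // n IH p ltp p' hp px.
have [p0|p0] := eqVneq p 0.
  move: hp; rewrite p0 => /pp0 ->.
  by rewrite /dval deriv0 !horner0 mul0r addr0.
have lemp := mmin _ _ hp px p0.
pose s := (size p - size m)%N.
pose lm := lead_coef m; pose lm' := m'`_(size m).-1.
pose lp := lead_coef p; pose lp' := p'`_(size p).-1.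
have hlm : polypair lm%:P lm'%:P by apply/ppC/hm.
have hlp : polypair lp%:P lp'%:P by apply/ppC/hp.
have hq := ppD (ppM hlm hp) (ppN (ppM (ppM hlp (ppXn s)) hm)).
set q := (X in polypair X _) in hq; set q' := (X in polypair _ X) in hq.
have qx : q.[x] = 0 by rewrite /q !hornerE px mx !mulr0 subr0.
have lm0 : lm != 0 by rewrite lead_coef_eq0.
have lp0 : lp != 0 by rewrite lead_coef_eq0.
have sq : (size q < size p)%N.
  have sp : (size p).-1.+1 = size p by rewrite prednK // size_poly_gt0.
  have sm : (size m).-1.+1 = size m by rewrite prednK // size_poly_gt0.
  have sE : (size p).-1 = (s + (size m).-1)%N by rewrite /s; lia.
  rewrite -sp ltnS; apply/leq_sizeP => j lej.
  rewrite /q -mulrA !(coefD, coefN, coefCM, coefXnM).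
  have -> : (j < s)%N = false by lia.
  move: lej; rewrite leq_eqVlt => /predU1P [<-|lt].
    by rewrite {2}sE addKn /lm /lp !lead_coefE mulrC subrr.
  have h1 : (size p <= j)%N by rewrite -sp.
  have h2 : (size m <= j - s)%N by rewrite -sm; move: h1; rewrite -sp sE; lia.
  by rewrite !nth_default // !mulr0 subrr.
have := IH q (leq_trans sq ltp) _ hq qx.
rewrite /dval /q /q' !derivE !(hornerD, hornerN, hornerM, hornerC) px mx /=.
have -> : m'.[x] = - (m^`().[x] * v) by apply/eqP; rewrite -addr_eq0; apply/eqP.
move=> h; apply: (mulfI lm0); rewrite mulr0 -{}[RHS]h; ring.
Qed.

Lemma dgraph_extend x :
  exists G', [/\ dgraph G', forall a a', G a a' -> G' a a' & exists v, G' x v].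
Proof.
have [v hv] : exists v, consistent x v.
  pose Q n := `[< exists p p', [/\ polypair p p', p.[x] = 0, p != 0 & size p = n] >].
  have [[n Qn]|nQ] := pselect (exists n, Q n); last first.
    exists 0; apply: consistent_transc => p p' hp px.
    apply/eqP; apply: contra_notT nQ => p0.
    by exists (size p); apply/asboolP; exists p, p'.
  case: (ex_minnP (ex_intro _ n Qn)) => N /asboolP [m [m' [hm mx m0 sm]]] minN.
  apply: consistent_alg hm mx m0 _ => p p' hp px p0.
  by rewrite sm; apply: minN; apply/asboolP; exists p, p'.
exists (dgext x v); split; first exact: dgext_graph.
- by move=> a a'; apply: dgext_sub.
- by exists v; apply: dgext_gen.
Qed.

End Graph.

Lemma dgraph_extend_seq G (s : seq K) : dgraph G ->
  exists G', [/\ dgraph G', forall a a', G a a' -> G' a a' &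
                 forall x, x \in s -> exists v, G' x v].
Proof.
elim: s G => [|x s IH] G dG; first by exists G.
have [G1 [dG1 sub1 [v hv]]] := dgraph_extend dG x.
have [G2 [dG2 sub2 h2]] := IH _ dG1.
exists G2; split=> // [a a' /sub1/sub2 //|y].
rewrite inE => /predU1P [->|/h2 //]; by exists v; apply: sub2.
Qed.

Definition dgconst (a a' : K) := (exists c, a = iota c) /\ a' = 0.

Lemma dgconst_graph : dgraph dgconst.
Proof.
split.
- by move=> c; split=> //; exists c.
- move=> a a' b b' [[c ->] ->] [[d ->] ->]; rewrite addr0; split=> //.
  by exists (c + d); rewrite rmorphD.
- move=> a a' b b' [[c ->] ->] [[d ->] ->]; rewrite mulr0 mul0r addr0; split=> //.
  by exists (c * d); rewrite rmorphM.
- move=> a a' [[c ->] ->]; rewrite oppr0 mul0r; split=> //.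
  by exists c^-1; rewrite fmorphV.
- by move=> a' [].
Qed.

Definition cderivation (D : K -> K) :=
  [/\ forall c, D (iota c) = 0, {morph D : a b / a + b} &
      forall a b, D (a * b) = D a * b + a * D b].

Lemma cderivation_ex (s : seq K) (f : K) :
  (forall G, dgraph G -> (forall x, x \in s -> exists v, G x v) ->
     forall x, exists v, G x v) ->
  ~ (exists c, f = iota c) -> exists2 D, cderivation D & D f != 0.
Proof.
move=> gen nf.
have cons : consistent dgconst f 1.
  apply: (consistent_transc dgconst_graph) => p p' hp pf.
  have /choice [c hc] : forall i, exists c, p`_i = iota c.
    by move=> i; have [[c ->] _] := hp i; exists c.
  have pE : p = map_poly iota (\poly_(i < size p) c i).
    apply/polyP => i; rewrite coef_map /= coef_poly.
    by case: ltnP => h; [apply: hc | rewrite rmorph0 nth_default].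
  apply/eqP; apply: contra_notT nf => p0.
  move: pf p0; rewrite pE; set q := (X in map_poly _ X).
  have [rs ->] := closed_field_poly_normal q.
  rewrite map_polyZ rmorph_prod /= hornerZ horner_prod => /eqP.
  rewrite mulf_eq0 => /orP [/eqP -> | ].
    by rewrite scale0r eqxx.
  rewrite prodf_seq_eq0 => /hasP [z _ /=].
  rewrite map_polyXsubC hornerXsubC subr_eq0 => /eqP fz _.
  by exists z.
have [G [dG sub hG]] := dgraph_extend_seq s (dgext_graph dgconst_graph cons).
have /choice [D hD] := gen _ dG hG.
exists D; first split.
- by move=> c; apply: (dg_uniq dG (hD _)); apply: (dgC dG).
- by move=> a b; apply: (dg_uniq dG (hD _)); apply: (dgD dG).
- by move=> a b; apply: (dg_uniq dG (hD _)); apply: (dgM dG).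
have -> : D f = 1; last exact: oner_neq0.
by apply: (dg_uniq dG (hD _)); apply: sub; apply: (dgext_gen dgconst_graph).
Qed.

End DerivationExtension.

(** * Zariski topology and regular functions *)

Section Mpoly.
Variables (n : nat) (C : fieldType).

Lemma mpoly_ring_ind (P : {mpoly C[n]} -> Prop) :
  (forall c, P c%:MP) -> (forall i, P 'X_i) ->
  (forall p q, P p -> P q -> P (p + q)) ->
  (forall p q, P p -> P q -> P (p * q)) -> forall p, P p.
Proof.
move=> PC PX PD PM p; rewrite [p]mpolyE.
apply: big_ind => [||m _]; [by rewrite -mpolyC0; apply: PC | exact: PD |].
rewrite -mul_mpolyC; apply: (PM _ _); first exact: PC.
rewrite mpolyXE_id; apply: big_ind => [|a b Pa Pb|i _]; [|by apply: (PM a b)|].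
  by rewrite -mpolyC1; apply: PC.
elim: (m i) => [|k IH]; first by rewrite expr0 -mpolyC1; apply: PC.
by rewrite exprS; apply: (PM _ _).
Qed.

Lemma dhomog_prod_ord m (I : finType) (mf : measure m)
    (F : I -> {mpoly C[m]}) (d : I -> nat) :
  (forall i, F i \is (d i).-homog for mf) ->
  \prod_i F i \is (\sum_i d i).-homog for mf.
Proof.
move=> h; elim/big_ind2: _ => [|p a q b|i _]; [exact: dhomog1 | exact: dhomogM | exact: h].
Qed.

Lemma dhomog_mmap m (mf : measure m) (h : 'I_n -> {mpoly C[m]}) (w : 'I_n -> nat)
    d (p : {mpoly C[n]}) :
  (forall i, h i \is (w i).-homog for mf) ->
  (forall e, e \in msupp p -> (\sum_i w i * e i)%N = d) ->
  mmap (@mpolyC m C) h p \is d.-homog for mf.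
Proof.
move=> hh hp; rewrite /mmap big_seq_cond.
apply: rpred_sum => e; rewrite andbT => /hp <-.
rewrite mul_mpolyC; apply: rpredZ; apply: dhomog_prod_ord => i.
exact: dhomogMn.
Qed.

Lemma dhomog_deriv (mf : measure n) d (p : {mpoly C[n]}) i j :
  mf U_(i)%MM = mf U_(j)%MM ->
  p \is d.-homog for mf -> 'X_j * p^`M(i) \is d.-homog for mf.
Proof.
move=> eij /dhomogP hp; apply/dhomogP => m /msuppM_le/allpairsP [[m1 m2] /=].
rewrite msuppX inE => -[/eqP -> hm ->]; rewrite mfD -eij.
rewrite addnC -mfD; apply: hp; move: hm; rewrite !mcoeff_msupp mcoeff_mderiv.
by apply: contraNneq => ->; rewrite mul0rn.
Qed.

Lemma dhomog_meval d (p : {mpoly C[n]}) (c : C) (v w : 'I_n -> C) :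
  p \is d.-homog -> (forall i, w i = c * v i) -> p.@[w] = c ^+ d * p.@[v].
Proof.
move=> /dhomogP hp hw; rewrite !mevalE mulr_sumr; apply: eq_big_seq => m /hp <-.
rewrite mulrCA; congr (_ * _).
have -> : c ^+ mdeg m = \prod_i c ^+ m i by rewrite mdegE prodrXr.
rewrite -big_split /=.
by apply: eq_bigr => i _; rewrite hw exprMn.
Qed.

End Mpoly.

(* Fractions of functions on a space of points; [sec] and [sec2] are the two
   instances. *)
Section LocalFractions.
Variables (P : Type) (C : fieldType) (op : set P -> Prop).
Variable (H : int -> (P -> C) -> (P -> C) -> Prop).

Record fractions : Prop := Fractions {
  opI : forall A B, op A -> op B -> op (A `&` B);
  fracC : forall c, H 0 (fun=> c) (fun=> 1);
  fracD : forall d F G F' G', H d F G -> H d F' G' ->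
    H d (fun x => F x * G' x + F' x * G x) (fun x => G x * G' x);
  fracM : forall d e F G F' G', H d F G -> H e F' G' ->
    H (d + e) (fun x => F x * F' x) (fun x => G x * G' x) }.

Definition locfrac (d : int) (U : set P) (f : P -> C) :=
  forall x, U x -> exists U', [/\ op U', U' x, U' `<=` U &
    exists F G, H d F G /\ forall y, U' y -> G y != 0 /\ f y = F y / G y].

Hypothesis fr : fractions.

Lemma locfrac_sub d U U' f : op U' -> U' `<=` U -> locfrac d U f -> locfrac d U' f.
Proof.
move=> oU' sub hf x U'x; have [V [oV Vx sV [F [G [hFG e]]]]] := hf x (sub _ U'x).
exists (U' `&` V); split; [exact: opI | by [] | by move=> y [] |].
by exists F, G; split=> // y [_ /e].
Qed.

Lemma locfrac_ext d U f g : (forall x, U x -> f x = g x) ->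
  locfrac d U f -> locfrac d U g.
Proof.
move=> e hf x Ux; have [V [oV Vx sV [F [G [hFG h]]]]] := hf x Ux.
exists V; split=> //; exists F, G; split=> // y Vy.
by have [-> <-] := h y Vy; rewrite e //; apply: sV.
Qed.

Lemma locfrac_local d U f : (forall x, U x -> exists V, [/\ op V, V x, V `<=` U &
  locfrac d V f]) -> locfrac d U f.
Proof.
move=> h x Ux; have [V [oV Vx sV /(_ x Vx) [V' [oV' V'x sV' ex]]]] := h x Ux.
by exists V'; split=> //; apply: subset_trans sV.
Qed.

Lemma locfracC c U : op U -> locfrac 0 U (fun=> c).
Proof.
move=> oU x Ux; exists U; split=> //; exists (fun=> c), (fun=> 1); split.
  exact: fracC.
by move=> y _; rewrite oner_neq0 divr1.
Qed.

Lemma locfracD d U f g : locfrac d U f -> locfrac d U g ->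
  locfrac d U (fun x => f x + g x).
Proof.
move=> hf hg x Ux; have [V [oV Vx sV [F [G [hFG e]]]]] := hf x Ux.
have [V' [oV' Vx' sV' [F' [G' [hFG' e']]]]] := hg x Ux.
exists (V `&` V'); split; [exact: opI | by [] | by move=> y [/sV] |].
exists (fun x => F x * G' x + F' x * G x), (fun x => G x * G' x).
split; first exact: fracD.
move=> y [/e [Gy ->] /e' [G'y ->]]; rewrite mulf_neq0 //; split=> //.
by field; rewrite Gy G'y.
Qed.

Lemma locfracM d e U f g : locfrac d U f -> locfrac e U g ->
  locfrac (d + e) U (fun x => f x * g x).
Proof.
move=> hf hg x Ux; have [V [oV Vx sV [F [G [hFG h]]]]] := hf x Ux.
have [V' [oV' Vx' sV' [F' [G' [hFG' h']]]]] := hg x Ux.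
exists (V `&` V'); split; [exact: opI | by [] | by move=> y [/sV] |].
exists (fun x => F x * F' x), (fun x => G x * G' x).
split; first exact: fracM.
move=> y [/h [Gy ->] /h' [G'y ->]]; rewrite mulf_neq0 //; split=> //.
by field; rewrite Gy G'y.
Qed.

Lemma locfracZ d c U f : op U -> locfrac d U f -> locfrac d U (fun x => c * f x).
Proof. by move=> oU hf; rewrite -[d]add0r; apply: locfracM hf; apply: locfracC. Qed.

Lemma locfrac_sum (I : Type) (s : seq I) U (f : I -> P -> C) d :
  locfrac d U (fun=> 0) -> (forall i, locfrac d U (f i)) ->
  locfrac d U (fun x => \sum_(i <- s) f i x).
Proof.
move=> h0 h; elim: s => [|i s IH].
  by apply: locfrac_ext h0 => x _; rewrite big_nil.
apply: locfrac_ext (locfracD (h i) IH) => x _; by rewrite big_cons.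
Qed.

End LocalFractions.

Section Zariski.
Variables (R : realType) (r : nat).
Notation C := R[i].
Notation pt := 'rV[C]_r.+1.
Notation n := r.+1.
Implicit Types (X U : set pt) (x y : pt).

Definition nonvanishing X (S : set {mpoly C[n]}) : set pt :=
  [set x | X x /\ exists2 f, S f & f.@[x 0] != 0].

Lemma zopenP X U : X `<=` Pr -> zopen X U <-> exists2 S, homogs S & U = nonvanishing X S.
Proof.
move=> XP; split=> [[_ [S hS ->] ->]|[S hS ->]].
  exists S => //; apply/seteqP; split=> x /=.
    move=> [Xx /not_andP [//|/not_andP [|]]].
      by have := XP _ Xx; rewrite /Pr /= => -> /(_ isT).
    by move=> /existsNP [f /not_implyP [Sf /eqP nf]]; split=> //; exists f.
  move=> [Xx [f Sf /eqP nf]]; split=> // -[_ [_ /(_ f Sf)]].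
  exact: nf.
exists (X `&` zeros S); first by exists S.
apply/seteqP; split=> x /=.
  move=> [Xx [f Sf /eqP nf]]; split=> // -[_ [_ /(_ f Sf)]].
  exact: nf.
move=> [Xx /not_andP [//|/not_andP [|]]].
  by have := XP _ Xx; rewrite /Pr /= => -> /(_ isT).
by move=> /existsNP [f /not_implyP [Sf /eqP nf]]; split=> //; exists f.
Qed.

Section Variety.
Variable X : set pt.
Hypotheses (XP : X `<=` Pr) (irrX : zirreducible X).

Lemma zopen_sub U : zopen X U -> U `<=` X.
Proof. by move/(zopenP _ XP) => [S _ ->] x []. Qed.

Lemma zopenX : zopen X X.
Proof.
apply/zopenP => //; exists [set 1].
  by move=> _ ->; exists 0%N; apply: dhomog1.
apply/seteqP; split=> [x Xx|x []//]; split=> //; exists 1 => //.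
by rewrite meval1 oner_neq0.
Qed.

Lemma zopenI U U' : zopen X U -> zopen X U' -> zopen X (U `&` U').
Proof.
move=> /(zopenP _ XP) [S hS ->] /(zopenP _ XP) [S' hS' ->]; apply/zopenP => //.
exists [set h | exists f g, [/\ S f, S' g & h = f * g]].
  move=> _ [f [g [/hS [a ha] /hS' [b hb] ->]]]; exists (a + b)%N.
  exact: dhomogM.
apply/seteqP; split=> x /=.
  move=> [[Xx [f Sf nf]] [_ [g Sg ng]]]; split=> //; exists (f * g).
    by exists f, g.
  by rewrite mevalM mulf_neq0.
move=> [Xx [_ [f [g [Sf Sg ->]]]]]; rewrite mevalM mulf_eq0 negb_or => /andP [nf ng].
by split; split=> //; [exists f | exists g].
Qed.

Definition basic (F : {mpoly C[n]}) : set pt := [set x | X x /\ F.@[x 0] != 0].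

Lemma zopen_basic d F : F \is d.-homog -> zopen X (basic F).
Proof.
move=> hF; apply/zopenP => //; exists [set F]; first by move=> _ ->; exists d.
apply/seteqP; split=> x /= [Xx]; first by move=> nF; split=> //; exists F.
by move=> [_ ->].
Qed.

Lemma coord_basic x : X x -> exists i, basic 'X_i x.
Proof.
move=> Xx; have /rV0Pn [i ni] := XP Xx.
by exists i; split=> //; rewrite mevalXU.
Qed.

Lemma homogX i : 'X_i \is [in C[n], 1.-homog].
Proof. by rewrite dhomogX /= mdeg1. Qed.

Lemma zopen_coord i : zopen X (basic 'X_i).
Proof. exact: zopen_basic (homogX i). Qed.

Lemma zopen_meet U U' : zopen X U -> zopen X U' -> U !=set0 -> U' !=set0 ->
  (U `&` U') !=set0.
Proof.
move=> oU oU' [x Ux] [x' Ux']; apply/set0P/eqP => UU'.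
have [_ irr] := irrX; case: oU oU' Ux Ux' UU' => [Z cZ ->] [Z' cZ' ->].
move=> [Xx nZ] [Xx' nZ'] e.
have := irr Z Z' cZ cZ'; case.
- apply/seteqP; split=> y.
    move=> Xy; have [Zy|Zy] := pselect (Z y); first by left.
    right; apply: contrapT => Z'y.
    have : ((X `\` Z) `&` (X `\` Z')) y by split.
    by rewrite e.
  by case: cZ cZ' => [S _ ->] [S' _ ->] [[]|[]].
- by move=> eX; apply: nZ; rewrite -eX.
- by move=> eX; apply: nZ'; rewrite -eX.
Qed.

Definition isfrac (d : int) (F G : pt -> C) := exists (p q : nat) (f g : {mpoly C[n]}),
  [/\ f \is p.-homog, g \is q.-homog, p%:Z - q%:Z = d,
      F = (fun x => f.@[x 0]) & G = (fun x => g.@[x 0])].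

Lemma secE d U f : sec X d U f <-> locfrac (zopen X) isfrac d U f.
Proof.
split=> h x Ux; have [V [oV Vx sV]] := h x Ux.
  move=> [p [q [F [G [hF hG e FG]]]]]; exists V; split=> //.
  by exists (fun x => F.@[x 0]), (fun x => G.@[x 0]); split=> //; exists p, q, F, G.
move=> [_ [_ [[p [q [F [G [hF hG e -> ->]]]]] FG]]]; exists V; split=> //.
by exists p, q, F, G.
Qed.

Lemma fractions_sec : fractions (zopen X) isfrac.
Proof.
split.
- exact: zopenI.
- move=> c; exists 0%N, 0%N, c%:MP, 1; split=> //; last by apply/funext => x; rewrite meval1.
  + by rewrite -[c%:MP]mulr1 mul_mpolyC; apply: rpredZ; apply: dhomog1.
  + exact: dhomog1.
  + by apply/funext => x; rewrite mevalC.
- move=> d F G F' G' [p [q [f [g [hf hg e -> ->]]]]] [p' [q' [f' [g' [hf' hg' e' -> ->]]]]].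
  exists (p + q')%N, (q + q')%N, (f * g' + f' * g), (g * g'); split.
  + have h : f' * g \is (p + q').-homog.
      by have -> : (p + q' = p' + q)%N by [lia]; apply: dhomogM.
    exact: rpredD (dhomogM hf hg') h.
  + exact: dhomogM.
  + lia.
  + by apply/funext => x; rewrite !(mevalD, mevalM).
  + by apply/funext => x; rewrite !(mevalD, mevalM).
- move=> d d' F G F' G' [p [q [f [g [hf hg e -> ->]]]]] [p' [q' [f' [g' [hf' hg' e' -> ->]]]]].
  exists (p + p')%N, (q + q')%N, (f * f'), (g * g'); split.
  + exact: dhomogM.
  + exact: dhomogM.
  + lia.
  + by apply/funext => x; rewrite !(mevalD, mevalM).
  + by apply/funext => x; rewrite !(mevalD, mevalM).
Qed.

Let fr := fractions_sec.

Lemma sec_sub d U U' f : zopen X U' -> U' `<=` U -> sec X d U f -> sec X d U' f.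
Proof. by move=> oU' s /secE h; apply/secE; apply: locfrac_sub h. Qed.

Lemma sec_ext d U f g : (forall x, U x -> f x = g x) -> sec X d U f -> sec X d U g.
Proof. by move=> e /secE h; apply/secE; apply: locfrac_ext h. Qed.

Lemma sec_local d U f : (forall x, U x -> exists V, [/\ zopen X V, V x, V `<=` U &
  sec X d V f]) -> sec X d U f.
Proof.
move=> h; apply/secE; apply: locfrac_local => x /h [V [oV Vx sV /secE hV]].
by exists V; split.
Qed.

Lemma secC c U : zopen X U -> sec X 0 U (fun=> c).
Proof. by move=> oU; apply/secE; apply: locfracC. Qed.

Lemma secD d U f g : sec X d U f -> sec X d U g -> sec X d U (fun x => f x + g x).
Proof. by move=> /secE hf /secE hg; apply/secE; apply: locfracD. Qed.

Lemma secM d e U f g : sec X d U f -> sec X e U g ->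
  sec X (d + e) U (fun x => f x * g x).
Proof. by move=> /secE hf /secE hg; apply/secE; apply: locfracM. Qed.

Lemma secM0 U f g : sec X 0 U f -> sec X 0 U g -> sec X 0 U (fun x => f x * g x).
Proof. by move=> hf hg; rewrite -[X in sec _ X]addr0; apply: secM. Qed.

Lemma secZ d c U f : zopen X U -> sec X d U f -> sec X d U (fun x => c * f x).
Proof. by move=> oU /secE hf; apply/secE; apply: locfracZ. Qed.

Lemma sec_frac p q (F G : {mpoly C[n]}) U d : zopen X U ->
  F \is p.-homog -> G \is q.-homog -> p%:Z - q%:Z = d ->
  (forall x, U x -> G.@[x 0] != 0) -> sec X d U (fun x => F.@[x 0] / G.@[x 0]).
Proof.
move=> oU hF hG e nG x Ux; exists U; split=> //.
by exists p, q, F, G; split=> // y Uy; split=> //; apply: nG.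
Qed.

Lemma sec0 d U : zopen X U -> sec X d U (fun=> 0).
Proof.
move=> oU; have [p [q e]] : exists p q : nat, p%:Z - q%:Z = d.
  by exists `|Num.max d 0|%N, `|Num.max (- d) 0|%N; lia.
apply: sec_local => x Ux; have [i Vx] := coord_basic (zopen_sub oU Ux).
have hG := dhomogMn q (homogX i).
exists (U `&` basic 'X_i); split=> //; last first.
- have := sec_frac (zopenI oU (zopen_coord i)) (dhomog0 _ mdeg p) hG _ _.
  move=> /(_ d); rewrite mul1n => /(_ e) h; apply: sec_ext (h _) => [y _|y [_ [_ ny]]].
    by rewrite meval0 mul0r.
  by rewrite rmorphXn expf_neq0.
- exact: zopenI (zopen_coord i).
Qed.

Lemma sec_sum (I : Type) (s : seq I) U (f : I -> pt -> C) d : zopen X U ->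
  (forall i, sec X d U (f i)) -> sec X d U (fun x => \sum_(i <- s) f i x).
Proof.
move=> oU h; apply/secE; apply: locfrac_sum => //; first exact/secE/sec0.
by move=> i; apply/secE.
Qed.

Lemma secV d U f : (forall x, U x -> f x != 0) -> sec X d U f ->
  sec X (- d) U (fun x => (f x)^-1).
Proof.
move=> nf hf x Ux; have [V [oV Vx sV [p [q [F [G [hF hG e h]]]]]]] := hf x Ux.
exists V; split=> //; exists q, p, G, F; split=> //; first by lia.
move=> y Vy; have := nf y (sV _ Vy); have [nG ->] := h y Vy.
by rewrite mulf_eq0 negb_or invf_div => /andP [].
Qed.

Lemma sec_dense d U V f : zopen X U -> sec X d U f -> zopen X V -> V !=set0 ->
  (forall x, V x -> U x -> f x = 0) -> forall x, U x -> f x = 0.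
Proof.
move=> oU hf oV V0 f0 x Ux; have [W [oW Wx sW [p [q [F [G [hF hG e h]]]]]]] := hf x Ux.
have [nG ->] := h x Wx; apply/eqP; rewrite mulf_eq0 invr_eq0 (negPf nG) orbF.
apply: contrapT => /negP nF.
have oF := zopenI oW (zopen_basic hF).
have [|y [[Wy [Xy nFy]] Vy]] := zopen_meet oF oV _ V0.
  by exists x; split=> //; split=> //; apply: zopen_sub Ux.
have := f0 y Vy (sW _ Wy); have [nGy ->] := h y Wy.
by move/eqP; rewrite mulf_eq0 invr_eq0 (negPf nGy) (negPf nFy).
Qed.

Lemma sec_nonzero d U f x : zopen X U -> sec X d U f -> U x -> f x != 0 ->
  exists V, [/\ zopen X V, V x, V `<=` U & forall y, V y -> f y != 0].
Proof.
move=> oU hf Ux nf; have [W [oW Wx sW [p [q [F [G [hF hG e h]]]]]]] := hf x Ux.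
exists (W `&` basic F); split.
- exact: zopenI (zopen_basic hF).
- split=> //; split; first exact: zopen_sub Ux.
  by apply: contraNneq nf => F0; have [_ ->] := h x Wx; rewrite F0 mul0r.
- by move=> y [/sW].
- move=> y [Wy [_ nF]]; have [nG ->] := h y Wy.
  by rewrite mulf_neq0 ?invr_eq0.
Qed.

End Variety.
End Zariski.

(** * The product *)

Section Bidegrees.
Variable r : nat.
Notation n := r.+1.

Definition ldeg (m : 'X_{1..n + n}) := (\sum_(i < n) m (lshift n i))%N.
Definition rdeg (m : 'X_{1..n + n}) := (\sum_(i < n) m (rshift n i))%N.

Lemma ldeg0 : ldeg 0%MM = 0%N.
Proof. by rewrite /ldeg big1 // => i _; rewrite mnm0E. Qed.
Lemma rdeg0 : rdeg 0%MM = 0%N.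
Proof. by rewrite /rdeg big1 // => i _; rewrite mnm0E. Qed.
Lemma ldegD : {morph ldeg : a b / (a + b)%MM >-> (a + b)%N}.
Proof. by move=> a b; rewrite /ldeg -big_split; apply: eq_bigr => i _; rewrite mnmDE. Qed.
Lemma rdegD : {morph rdeg : a b / (a + b)%MM >-> (a + b)%N}.
Proof. by move=> a b; rewrite /rdeg -big_split; apply: eq_bigr => i _; rewrite mnmDE. Qed.

HB.instance Definition _ := isMeasure.Build (n + n) ldeg ldeg0 ldegD.
HB.instance Definition _ := isMeasure.Build (n + n) rdeg rdeg0 rdegD.

Lemma ldegU i : ldeg U_(lshift n i)%MM = 1%N.
Proof.
rewrite /ldeg (bigD1 i) //= mnm1E eqxx big1 // => j ji.
by rewrite mnm1E (inj_eq (@lshift_inj _ _)) eq_sym (negPf ji).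
Qed.
Lemma ldegUr i : ldeg U_(rshift n i)%MM = 0%N.
Proof. by rewrite /ldeg big1 // => j _; rewrite mnm1E eq_rlshift. Qed.
Lemma rdegU i : rdeg U_(rshift n i)%MM = 1%N.
Proof.
rewrite /rdeg (bigD1 i) //= mnm1E eqxx big1 // => j ji.
by rewrite mnm1E (inj_eq (@rshift_inj _ _)) eq_sym (negPf ji).
Qed.
Lemma rdegUl i : rdeg U_(lshift n i)%MM = 0%N.
Proof. by rewrite /rdeg big1 // => j _; rewrite mnm1E eq_lrshift. Qed.

End Bidegrees.

Section Product.
Variables (R : realType) (r : nat).
Notation C := R[i].
Notation pt := 'rV[C]_r.+1.
Notation n := r.+1.
Implicit Types (p q : {mpoly C[n + n]}).

Lemma bihomogE d e p :
  bihomog d e p <-> p \is d.-homog for (@ldeg r) /\ p \is e.-homog for (@rdeg r).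
Proof.
split=> [h|[/dhomogP hl /dhomogP hr] m mp]; last by split; [apply: hl | apply: hr].
by split; apply/dhomogP => m /h [].
Qed.

Lemma bihomog0 a b : bihomog a b (0 : {mpoly C[n + n]}).
Proof. by move=> m; rewrite msupp0. Qed.

Lemma bihomogC c : bihomog 0 0 (c%:MP : {mpoly C[n + n]}).
Proof.
by apply/bihomogE; rewrite -[c%:MP]mulr1 mul_mpolyC; split;
   apply: rpredZ; apply: dhomog1.
Qed.

Lemma bihomog1 : bihomog 0 0 (1 : {mpoly C[n + n]}).
Proof. by rewrite -mpolyC1; apply: bihomogC. Qed.

Lemma bihomogD a b p q : bihomog a b p -> bihomog a b q -> bihomog a b (p + q).
Proof.
by move=> /bihomogE [h1 h2] /bihomogE [h3 h4]; apply/bihomogE; split; apply: rpredD.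
Qed.

Lemma bihomogN a b p : bihomog a b p -> bihomog a b (- p).
Proof. by move=> /bihomogE [h1 h2]; apply/bihomogE; split; rewrite rpredN. Qed.

Lemma bihomogM a b c d p q :
  bihomog a b p -> bihomog c d q -> bihomog (a + c) (b + d) (p * q).
Proof.
by move=> /bihomogE [h1 h2] /bihomogE [h3 h4]; apply/bihomogE; split; apply: dhomogM.
Qed.

Lemma bihomog_sum a b (I : Type) (s : seq I) (F : I -> {mpoly C[n + n]}) :
  (forall i, bihomog a b (F i)) -> bihomog a b (\sum_(i <- s) F i).
Proof.
move=> h; elim/big_ind: _ => [|p q|i _]; [exact: bihomog0 | exact: bihomogD | exact: h].
Qed.

Lemma bihomog_deriv a b p i j : bihomog a b p ->
  bihomog a b ('X_(lshift n j) * p^`M(lshift n i)).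
Proof.
move=> /bihomogE [h1 h2]; apply/bihomogE; split; apply: dhomog_deriv => //=.
  by rewrite !ldegU.
by rewrite !rdegUl.
Qed.

Lemma bihomogXr i : bihomog 0 1 ('X_(rshift n i) : {mpoly C[n + n]}).
Proof. by apply/bihomogE; split; rewrite dhomogX /= ?ldegUr ?rdegU. Qed.

Lemma bievalM p q z : bieval (p * q) z = bieval p z * bieval q z.
Proof. exact: mevalM. Qed.
Lemma bievalD p q z : bieval (p + q) z = bieval p z + bieval q z.
Proof. exact: mevalD. Qed.
Lemma bievalN p z : bieval (- p) z = - bieval p z.
Proof. exact: mevalN. Qed.
Lemma bievalC c z : bieval (c%:MP : {mpoly C[n + n]}) z = c.
Proof. exact: mevalC. Qed.
Lemma bieval1 z : bieval (1 : {mpoly C[n + n]}) z = 1.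
Proof. exact: meval1. Qed.
Lemma bieval_sum (I : Type) (s : seq I) (F : I -> {mpoly C[n + n]}) z :
  bieval (\sum_(i <- s) F i) z = \sum_(i <- s) bieval (F i) z.
Proof. exact: raddf_sum. Qed.
Lemma bievalXl i z : bieval ('X_(lshift n i) : {mpoly C[n + n]}) z = z.1 0 i.
Proof. by rewrite /bieval mevalXU row_mxEl. Qed.
Lemma bievalXr i z : bieval ('X_(rshift n i) : {mpoly C[n + n]}) z = z.2 0 i.
Proof. by rewrite /bieval mevalXU row_mxEr. Qed.

(* Locked, because conversion problems that unfold [mmap] do not terminate in
   practice; the same holds for [slice]. *)
Definition pull1 (f : {mpoly C[n]}) : {mpoly C[n + n]} :=
  locked (mmap (@mpolyC _ C) (fun i => 'X_(lshift n i))) f.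

Lemma pull1D f g : pull1 (f + g) = pull1 f + pull1 g.
Proof. by rewrite /pull1; unlock; apply: mmapD. Qed.
Lemma pull1M f g : pull1 (f * g) = pull1 f * pull1 g.
Proof. by rewrite /pull1; unlock; apply: (rmorphM (mmap (@mpolyC (n + n) C) _)). Qed.

Lemma bieval_pull1 f (z : pt * pt) : bieval (pull1 f) z = f.@[z.1 0].
Proof.
elim/mpoly_ring_ind: f => [c|i|f g hf hg|f g hf hg].
- by rewrite /pull1; unlock; rewrite mmapC bievalC mevalC.
- by rewrite /pull1; unlock; rewrite mmapX mmap1U bievalXl mevalXU.
- by rewrite pull1D bievalD mevalD; congr (_ + _).
- by rewrite pull1M bievalM mevalM; congr (_ * _).
Qed.

Lemma bihomog_pull1 d f : f \is d.-homog -> bihomog d 0 (pull1 f).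
Proof.
move=> /dhomogP h; apply/bihomogE; rewrite /pull1; unlock; split.
  apply: (dhomog_mmap (w := fun=> 1%N)) => [i|e /h <-].
    by rewrite dhomogX /= ldegU.
  by rewrite /= mdegE; apply: eq_bigr => i _; rewrite mul1n.
apply: (dhomog_mmap (w := fun=> 0%N)) => [i|e _].
  by rewrite dhomogX /= rdegUl.
by rewrite big1.
Qed.

Definition slice (y : pt) p : {mpoly C[n]} :=
  locked (mmap (@mpolyC _ C)
    (fun i => match split i with inl j => 'X_j | inr j => (y 0 j)%:MP end)) p.

Lemma sliceXl y i : slice y 'X_(lshift n i) = 'X_i.
Proof. by rewrite /slice; unlock; rewrite mmapX mmap1U (unsplitK (inl i)). Qed.
Lemma sliceXr y i : slice y 'X_(rshift n i) = (y 0 i)%:MP.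
Proof. by rewrite /slice; unlock; rewrite mmapX mmap1U (unsplitK (inr i)). Qed.

Lemma sliceD y p q : slice y (p + q) = slice y p + slice y q.
Proof. by rewrite /slice; unlock; apply: mmapD. Qed.
Lemma sliceM y p q : slice y (p * q) = slice y p * slice y q.
Proof. by rewrite /slice; unlock; apply: (rmorphM (mmap (@mpolyC n C) _)). Qed.
Lemma sliceC y c : slice y c%:MP = c%:MP.
Proof. by rewrite /slice; unlock; rewrite mmapC. Qed.

Lemma slice0 y : slice y 0 = 0.
Proof. by rewrite -mpolyC0 sliceC mpolyC0. Qed.
Lemma slice1 y : slice y 1 = 1.
Proof. by rewrite -mpolyC1 sliceC mpolyC1. Qed.

Lemma meval_slice y p (x : pt) : (slice y p).@[x 0] = bieval p (x, y).
Proof.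
elim/mpoly_ring_ind: p => [c|i|f g hf hg|f g hf hg].
- by rewrite sliceC bievalC mevalC.
- rewrite -(splitK i); case: (split i) => j /=.
    by rewrite sliceXl bievalXl mevalXU.
  by rewrite sliceXr bievalXr mevalC.
- by rewrite sliceD bievalD mevalD; congr (_ + _).
- by rewrite sliceM bievalM mevalM; congr (_ * _).
Qed.

Lemma slice_homog y d e p : bihomog d e p -> slice y p \is d.-homog.
Proof.
move=> h; rewrite /slice; unlock; apply: (dhomog_mmap (w := fun i => if split i is inl _ then 1%N else 0%N)).
  move=> i; case: (split i) => j; first by rewrite dhomogX /= mdeg1.
  by rewrite -[(_)%:MP]mulr1 mul_mpolyC; apply: rpredZ; apply: dhomog1.
move=> m /h [<- _]; rewrite big_split_ord /= [X in (_ + X)%N]big1 ?addn0.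
  by apply: eq_bigr => i _; rewrite (unsplitK (inl i)) mul1n.
by move=> i _; rewrite (unsplitK (inr i)).
Qed.

Lemma slice_deriv y p i : slice y p^`M(lshift n i) = (slice y p)^`M(i).
Proof.
elim/mpoly_ring_ind: p => [c|j|f g hf hg|f g hf hg].
- by rewrite sliceC !mderivC slice0.
- rewrite -(splitK j); case: (split j) => l /=; rewrite mderivX mnm1E.
    rewrite sliceXl mderivX mnm1E (inj_eq (@lshift_inj _ _)).
    case: eqP => [->|_]; last by rewrite !scale0r slice0.
    have mm k (m : 'X_{1..k}) : (m - m)%MM = 0%MM by rewrite -{1}[m]add0m addmK.
    by rewrite !scale1r !mm !mpolyX0 slice1.
  by rewrite eq_rlshift scale0r sliceXr mderivC slice0.
- by rewrite mderivD !sliceD mderivD; congr (_ + _).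
- by rewrite mderivM sliceD !sliceM mderivM; congr (_ * _ + _ * _).
Qed.

Variable X : set pt.
Hypotheses (XP : X `<=` Pr).

Lemma zopen2X : zopen2 X [set z | X z.1 /\ X z.2].
Proof.
exists [set 1]; first by move=> _ ->; exists 0%N, 0%N; apply: bihomog1.
apply/seteqP; split=> z /=; last by case.
by move=> [h1 h2]; split=> //; exists 1 => //; rewrite bieval1 oner_neq0.
Qed.

Lemma zopen2_sub W z : zopen2 X W -> W z -> X z.1 /\ X z.2.
Proof. by move=> [S _ ->] []. Qed.

Lemma zopen2I W W' : zopen2 X W -> zopen2 X W' -> zopen2 X (W `&` W').
Proof.
move=> [S hS ->] [S' hS' ->].
exists [set h | exists f g, [/\ S f, S' g & h = f * g]].
  move=> _ [f [g [/hS [a [b ha]] /hS' [c [d hb]] ->]]]; exists (a + c)%N, (b + d)%N.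
  exact: bihomogM.
apply/seteqP; split=> z /=.
  move=> [[Xz Yz [f Sf nf]] [_ _ [g Sg ng]]]; split=> //; exists (f * g).
    by exists f, g.
  by rewrite bievalM mulf_neq0.
move=> [Xz Yz [_ [f [g [Sf Sg ->]]]]]; rewrite bievalM mulf_eq0 negb_or => /andP [nf ng].
by split; split=> //; [exists f | exists g].
Qed.

Lemma zopen2_pull1 U : zopen X U -> zopen2 X [set z | U z.1 /\ X z.2].
Proof.
move=> /(zopenP _ XP) [S hS ->].
exists (pull1 @` S).
  by move=> _ [f /hS [d hd] <-]; exists d, 0%N; apply: bihomog_pull1.
apply/seteqP; split=> z /=.
  by move=> [[Xz [f Sf nf]] Xz2]; split=> //; exists (pull1 f); [exists f|rewrite bieval_pull1].
move=> [X1 X2 [_ [f Sf <-]]]; rewrite bieval_pull1 => nf.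
by split=> //; split=> //; exists f.
Qed.

Lemma zopen_slice W y : zopen2 X W -> zopen X [set x | W (x, y)].
Proof.
move=> [S hS ->]; apply/zopenP => //.
have [Xy|nXy] := pselect (X y); last first.
  by exists set0 => //; apply/seteqP; split=> x [] // _ [].
exists (slice y @` S).
  by move=> _ [f /hS [a [b h]] <-]; exists a; apply: slice_homog h.
apply/seteqP; split=> x /=.
  move=> [Xx _ [f Sf nf]]; split=> //.
  by exists (slice y f); [exists f|rewrite meval_slice].
move=> [Xx [_ [f Sf <-]]]; rewrite meval_slice => nf.
by split=> //; exists f.
Qed.

Definition isfrac2 (e : int) (F G : pt * pt -> C) :=
  exists (p q q' : nat) (f g : {mpoly C[n + n]}),
  [/\ bihomog p q f, bihomog p q' g, q%:Z - q'%:Z = e,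
      F = bieval f & G = bieval g].

Lemma sec2E e W g : sec2 X 0 e W g <-> locfrac (zopen2 X) isfrac2 e W g.
Proof.
split=> h z Wz; have [V [oV Vz sV]] := h z Wz.
  move=> [p [q [p' [q' [F [G [hF hG ep eq FG]]]]]]]; exists V; split=> //.
  have pp' : p = p' by lia.
  by exists (bieval F), (bieval G); split=> //; exists p, q, q', F, G; rewrite {2}pp'.
move=> [_ [_ [[p [q [q' [F [G [hF hG e' -> ->]]]]]] FG]]]; exists V; split=> //.
by exists p, q, p, q', F, G; split=> //; rewrite subrr.
Qed.

Lemma fractions_sec2 : fractions (zopen2 X) isfrac2.
Proof.
split.
- exact: zopen2I.
- move=> c; exists 0%N, 0%N, 0%N, c%:MP, 1; split=> //.
  + exact: bihomogC.
  + exact: bihomog1.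
  + by apply/funext => x; rewrite bievalC.
  + by apply/funext => x; rewrite bieval1.
- move=> e F G F' G' [p [q [q' [f [g [hf hg h -> ->]]]]]].
  move=> [p1 [q1 [q1' [f' [g' [hf' hg' h' -> ->]]]]]].
  exists (p + p1)%N, (q + q1')%N, (q' + q1')%N, (f * g' + f' * g), (g * g'); split.
  + have h1 : bihomog (p + p1) (q + q1') (f' * g).
      have -> : (q + q1' = q1 + q')%N by lia.
      by rewrite addnC; apply: bihomogM.
    exact: bihomogD (bihomogM hf hg') h1.
  + exact: bihomogM.
  + lia.
  + by apply/funext => x; rewrite !(bievalD, bievalM).
  + by apply/funext => x; rewrite !(bievalD, bievalM).
- move=> e e' F G F' G' [p [q [q' [f [g [hf hg h -> ->]]]]]].
  move=> [p1 [q1 [q1' [f' [g' [hf' hg' h' -> ->]]]]]].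
  exists (p + p1)%N, (q + q1)%N, (q' + q1')%N, (f * f'), (g * g'); split.
  + exact: bihomogM.
  + exact: bihomogM.
  + lia.
  + by apply/funext => x; rewrite !(bievalD, bievalM).
  + by apply/funext => x; rewrite !(bievalD, bievalM).
Qed.

Let fr := fractions_sec2.

Lemma sec2_sub e W W' f : zopen2 X W' -> W' `<=` W -> sec2 X 0 e W f -> sec2 X 0 e W' f.
Proof. by move=> oW s /sec2E h; apply/sec2E; apply: locfrac_sub h. Qed.

Lemma sec2_ext e W f g : (forall x, W x -> f x = g x) ->
  sec2 X 0 e W f -> sec2 X 0 e W g.
Proof. by move=> h /sec2E hf; apply/sec2E; apply: locfrac_ext hf. Qed.

Lemma sec2C c W : zopen2 X W -> sec2 X 0 0 W (fun=> c).
Proof. by move=> oW; apply/sec2E; apply: locfracC. Qed.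

Lemma sec2D e W f g : sec2 X 0 e W f -> sec2 X 0 e W g ->
  sec2 X 0 e W (fun x => f x + g x).
Proof. by move=> /sec2E hf /sec2E hg; apply/sec2E; apply: locfracD. Qed.

Lemma sec2M e W f g : sec2 X 0 0 W f -> sec2 X 0 e W g ->
  sec2 X 0 e W (fun x => f x * g x).
Proof.
move=> /sec2E hf /sec2E hg; apply/sec2E.
by rewrite -[X in locfrac _ _ X]add0r; apply: locfracM.
Qed.

Lemma sec2Z e c W f : zopen2 X W -> sec2 X 0 e W f -> sec2 X 0 e W (fun x => c * f x).
Proof. by move=> oW; apply: sec2M; apply: sec2C. Qed.

Lemma sec2_coord i W : zopen2 X W -> sec2 X 0 1 W (fun z => z.2 0 i).
Proof.
move=> oW z Wz; exists W; split=> //.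
exists 0%N, 1%N, 0%N, 0%N, 'X_(rshift n i), 1; split=> //.
- exact: bihomogXr.
- exact: bihomog1.
- by move=> w _; rewrite bieval1 oner_neq0 bievalXr divr1.
Qed.

Lemma sec20 W : zopen2 X W -> sec2 X 0 1 W (fun=> 0).
Proof.
move=> oW; apply: sec2_ext (sec2Z 0 oW (sec2_coord 0 oW)) => z _.
by rewrite mul0r.
Qed.

Lemma sec2_pull1 U f W : zopen X U -> sec X 0 U f -> zopen2 X W ->
  (forall z, W z -> U z.1) -> sec2 X 0 0 W (fun z => f z.1).
Proof.
move=> oU hf oW WU z Wz.
have [V [oV Vx sV [p [q [F [G [hF hG e h]]]]]]] := hf z.1 (WU _ Wz).
exists (W `&` [set z | V z.1 /\ X z.2]); split.
- exact: zopen2I (zopen2_pull1 oV).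
- by split=> //; split=> //; have [] := zopen2_sub oW Wz.
- by move=> w [].
- exists p, 0%N, q, 0%N, (pull1 F), (pull1 G); split=> //.
  + exact: bihomog_pull1.
  + exact: bihomog_pull1.
  + by move=> w [_ [Vw _]]; rewrite !bieval_pull1; apply: h.
Qed.

Lemma sec2_slice e W g y : zopen2 X W -> sec2 X 0 e W g ->
  sec X 0 [set x | W (x, y)] (fun x => g (x, y)).
Proof.
move=> oW /sec2E hg x /= Wx.
have [V [oV Vx sV [_ [_ [[p [q [q' [F [G [hF hG e' -> ->]]]]]] FG]]]]] := hg _ Wx.
exists [set x | V (x, y)]; split=> //.
- exact: zopen_slice.
- by move=> x' /= /sV.
- exists p, p, (slice y F), (slice y G); split.
  + exact: slice_homog hF.
  + exact: slice_homog hG.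
  + by rewrite subrr.
  + by move=> x' Vx'; rewrite !meval_slice; apply: FG.
Qed.

End Product.

(** * Kernels of the Taylor series maps *)

Section Kernels.
Variables (R : realType) (r : nat).
Notation C := R[i].
Notation pt := 'rV[C]_r.+1.
Notation n := r.+1.
Variable X : set pt.
Hypotheses (XP : X `<=` Pr).

(* [diag_pow X k] is the case [d = k.+1]. *)
Definition Ipow (d : nat) (W : set (pt * pt)) (h : pt * pt -> C) : Prop :=
  exists (N : nat) (g : 'I_N -> 'I_d -> pt * pt -> C) (l : 'I_N -> pt * pt -> C),
    [/\ forall j i, diag_ideal X W (g j i),
        forall j, sec2 X 0 1 W (l j) &
        forall w, W w -> h w = \sum_j (\prod_i g j i w) * l j w].

Section Fixed.
Variable W : set (pt * pt).
Hypothesis oW : zopen2 X W.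

Lemma diag_ideal_sub W' g : zopen2 X W' -> W' `<=` W ->
  diag_ideal X W g -> diag_ideal X W' g.
Proof.
move=> oW' s [hg g0]; split; first exact: sec2_sub hg.
by move=> x /s /g0.
Qed.

Lemma Ipow_sub d W' h : zopen2 X W' -> W' `<=` W -> Ipow d W h -> Ipow d W' h.
Proof.
move=> oW' s [N [g [l [hg hl e]]]]; exists N, g, l; split.
- by move=> j i; apply: diag_ideal_sub (hg j i).
- by move=> j; apply: sec2_sub (hl j).
- by move=> w /s /e.
Qed.

Lemma Ipow_ext d h h' : (forall w, W w -> h w = h' w) -> Ipow d W h -> Ipow d W h'.
Proof.
move=> eh [N [g [l [hg hl e]]]]; exists N, g, l; split=> // w Ww.
by rewrite -eh // e.
Qed.

Lemma IpowD d h h' : Ipow d W h -> Ipow d W h' -> Ipow d W (fun w => h w + h' w).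
Proof.
move=> [N [g [l [hg hl e]]]] [N' [g' [l' [hg' hl' e']]]].
exists (N + N')%N.
exists (fun j => match split j with inl j1 => g j1 | inr j2 => g' j2 end).
exists (fun j => match split j with inl j1 => l j1 | inr j2 => l' j2 end).
split.
- by move=> j i; case: (split j).
- by move=> j; case: (split j).
- move=> w Ww; rewrite e // e' // big_split_ord /=; congr (_ + _).
    by apply: eq_bigr => j _; rewrite (unsplitK (inl j)).
  by apply: eq_bigr => j _; rewrite (unsplitK (inr j)).
Qed.

Lemma Ipow_zero d : Ipow d W (fun=> 0).
Proof.
exists 0%N, (fun _ _ _ => 0), (fun _ _ => 0); split=> [[]//|[]//|w _].
by rewrite big_ord0.
Qed.

Lemma IpowM d g h : sec2 X 0 0 W g -> Ipow d W h -> Ipow d W (fun w => g w * h w).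
Proof.
move=> hg [N [f [l [hf hl e]]]]; exists N, f, (fun j w => g w * l j w); split=> //.
  by move=> j; apply: sec2M.
move=> w Ww; rewrite e // mulr_sumr; apply: eq_bigr => j _; ring.
Qed.

Lemma IpowZ d c h : Ipow d W h -> Ipow d W (fun w => c * h w).
Proof. by apply: IpowM; apply: sec2C. Qed.

Lemma Ipow_sum d (I : Type) (s : seq I) (h : I -> pt * pt -> C) :
  (forall i, Ipow d W (h i)) -> Ipow d W (fun w => \sum_(i <- s) h i w).
Proof.
move=> hh; elim: s => [|i s IH].
  by apply: Ipow_ext (Ipow_zero d) => w _; rewrite big_nil.
apply: Ipow_ext (IpowD (hh i) IH) => w _; by rewrite big_cons.
Qed.

Lemma IpowS d h : Ipow d.+1 W h -> Ipow d W h.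
Proof.
move=> [N [g [l [hg hl e]]]].
exists N, (fun j i => g j (lift ord0 i)), (fun j w => g j ord0 w * l j w).
split=> //.
- by move=> j; apply: sec2M => //; have [] := hg j ord0.
- move=> w Ww; rewrite e //; apply: eq_bigr => j _.
  by rewrite big_ord_recl; ring.
Qed.

Lemma Ipow_mulI d g h : diag_ideal X W g -> Ipow d W h ->
  Ipow d.+1 W (fun w => g w * h w).
Proof.
move=> hg [N [f [l [hf hl e]]]].
exists N, (fun j i => if unlift ord0 i is Some i' then f j i' else g), l; split=> //.
- by move=> j i; case: (unlift _ _).
- move=> w Ww; rewrite e // mulr_sumr; apply: eq_bigr => j _.
  rewrite big_ord_recl unlift_none -!mulrA; congr (_ * (_ * _)).
  by apply: eq_bigr => i _; rewrite liftK.
Qed.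

Lemma Ipow_single h : sec2 X 0 1 W h -> Ipow 0 W h.
Proof.
move=> hh; exists 1%N, (fun _ _ _ => 0), (fun _ => h); split=> [? []//|//|w _].
by rewrite big_ord1 big_ord0 mul1r.
Qed.

Lemma Ipow_sec d h : Ipow d W h -> sec2 X 0 1 W h.
Proof.
elim: d h => [|d IH] h; last by move/IpowS/IH.
move=> [N [g [l [hg hl e]]]].
apply: (@sec2_ext _ _ _ _ _ (fun w => \sum_j l j w)).
  by move=> w Ww; rewrite e //; apply: eq_bigr => j _; rewrite big_ord0 mul1r.
rewrite -[index_enum _]/(index_enum _); elim: (index_enum _) => [|j s IHs].
  by apply: sec2_ext (sec20 oW) => w _; rewrite big_nil.
by apply: sec2_ext (sec2D (hl j) IHs) => w _; rewrite big_cons.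
Qed.

End Fixed.

Lemma pp_class_eq k m m' z W : zopen2 X W -> W z ->
  Ipow k.+1 W (fun w => m w - m' w) -> pp_class X k m z = pp_class X k m' z.
Proof.
have main : forall m m' W, zopen2 X W -> W z ->
    Ipow k.+1 W (fun w => m w - m' w) -> pp_class X k m z `<=` pp_class X k m' z.
  move=> {}m {}m' {}W oW Wz hI s [W' [oW' W'z hs hI']].
  have oWW := zopen2I oW oW'.
  exists (W `&` W'); split=> //; first by apply: sec2_sub hs => // w [].
  have h1 : Ipow k.+1 (W `&` W') (fun w => m w - m' w) by apply: Ipow_sub hI => // w [].
  have h2 : Ipow k.+1 (W `&` W') (fun w => s w - m w) by apply: Ipow_sub hI' => // w [].
  by apply: Ipow_ext (IpowD h1 h2) => w _; ring.
move=> oW Wz hI; apply/seteqP; split; first by apply: (main _ _ _ oW Wz hI).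
apply: (main _ _ _ oW Wz _).
apply: Ipow_ext (IpowZ oW (-1) hI) => w _; ring.
Qed.

Lemma pp_class_self k m z W : zopen2 X W -> W z -> sec2 X 0 1 W m ->
  pp_class X k m z m.
Proof.
move=> oW Wz hm; exists W; split=> //.
by apply: Ipow_ext (Ipow_zero W k.+1) => w _; rewrite subrr.
Qed.

Lemma pp_scaleE k a t z W : zopen2 X W -> W z ->
  sec2 X 0 0 W (fun w => a w.1) -> sec2 X 0 1 W t ->
  pp_scale X k a (pp_class X k t) z = pp_class X k (fun w => a w.1 * t w) z.
Proof.
move=> oW Wz ha ht; apply/seteqP; split=> m.
  move=> [m0 [W' [oW' W'z hm0 hI]]].
  have oWW := zopen2I oW oW'.
  rewrite (@pp_class_eq k _ (fun w => a w.1 * t w) z _ oWW) //.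
  have h1 : Ipow k.+1 (W `&` W') (fun w => m0 w - t w) by apply: Ipow_sub hI => // w [].
  have h2 : sec2 X 0 0 (W `&` W') (fun w => a w.1) by apply: sec2_sub ha => // w [].
  by apply: Ipow_ext (IpowM h2 h1) => w _; ring.
move=> hm; exists t => //; exact: pp_class_self oW Wz ht.
Qed.

Lemma pp_addE k (s t : ppfun) m m' z W : zopen2 X W -> W z ->
  sec2 X 0 1 W m -> s z = pp_class X k m z -> t z = pp_class X k m' z ->
  pp_add s t z = pp_class X k (fun w => m w + m' w) z.
Proof.
move=> oW Wz hm hs ht; apply/seteqP; split=> p.
  move=> [m1 [m2 []]]; rewrite hs ht => -[W1 [oW1 W1z h1 hI1]] [W2 [oW2 W2z h2 hI2]] ->.
  have oWW := zopen2I oW1 oW2.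
  exists (W1 `&` W2); split=> //.
    by apply: sec2D; [apply: sec2_sub h1 | apply: sec2_sub h2] => // w [].
  have h3 : Ipow k.+1 (W1 `&` W2) (fun w => m1 w - m w) by apply: Ipow_sub hI1 => // w [].
  have h4 : Ipow k.+1 (W1 `&` W2) (fun w => m2 w - m' w) by apply: Ipow_sub hI2 => // w [].
  by apply: Ipow_ext (IpowD h3 h4) => w _; ring.
move=> [W1 [oW1 W1z h1 hI1]].
exists m, (fun w => p w - m w); split.
- by rewrite hs; apply: pp_class_self oW Wz hm.
- rewrite ht; have oWW := zopen2I oW oW1.
  exists (W `&` W1); split=> //.
    apply: (@sec2_ext _ _ _ _ _ (fun w => p w + -1 * m w)) => [w _|]; first by ring.
    by apply: sec2D; [apply: sec2_sub h1 | apply: sec2Z => //; apply: sec2_sub hm] => // w [].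
  have h3 : Ipow k.+1 (W `&` W1) (fun w => p w - (m w + m' w)).
    by apply: Ipow_sub hI1 => // w [].
  by apply: Ipow_ext h3 => w _; ring.
- by apply/funext => w; ring.
Qed.

(* The element of pr_2^* L that represents the sum of the a_i d^k T_i. *)
Definition taylor_rep (a : pt -> pt) (w : pt * pt) : C := \sum_i a w.1 0 i * w.2 0 i.

Lemma lform_delta i x : lform (delta_mx 0 i : pt) x = x 0 i.
Proof.
rewrite /lform (bigD1 i) //= mxE !eqxx mul1r big1 ?addr0 // => j ji.
by rewrite mxE eqxx (negPf ji) mul0r.
Qed.

Lemma taylorE k U a z : zopen X U -> VO X U a -> U z.1 -> X z.2 ->
  taylor X k a z = pp_class X k (taylor_rep a) z.
Proof.
move=> oU ha Uz Xz; pose W := [set w : pt * pt | U w.1 /\ X w.2].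
have oW : zopen2 X W by apply: zopen2_pull1.
have Wz : W z by [].
have ai i : sec2 X 0 0 W (fun w => a w.1 0 i).
  by apply: (sec2_pull1 (f := fun x => a x 0 i) XP oU (ha i) oW) => w [].
have term i : sec2 X 0 1 W (fun w => a w.1 0 i * w.2 0 i).
  by apply: sec2M => //; apply: sec2_coord.
have -> : taylor X k a z = pp_class X k (fun w => \sum_i a w.1 0 i * w.2 0 i) z by
  rewrite /taylor; elim: (index_enum _) => [|i s IH];
  [rewrite big_nil; apply: (pp_class_eq oW Wz);
   apply: Ipow_ext (Ipow_zero W k.+1) => w _; rewrite big_nil subrr
  |rewrite big_cons (@pp_addE k _ _ (fun w => a w.1 0 i * w.2 0 i) _ z W oW Wz (term i) _ IH);
   [congr (pp_class X k _ z); apply/funext => w; rewrite big_cons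
   |rewrite (pp_scaleE k oW Wz (ai i)) //;
    [congr (pp_class X k _ z); apply/funext => w; rewrite lform_delta
    |apply: sec2_ext (sec2_coord i oW) => w _; rewrite lform_delta]]].
by [].
Qed.

Lemma kerP k U a : zopen X U ->
  ker_taylor X k U a <-> VO X U a /\ forall z, U z.1 -> X z.2 ->
    exists W, [/\ zopen2 X W, W z & Ipow k.+1 W (taylor_rep a)].
Proof.
move=> oU; split=> -[ha hz]; split=> // z Uz Xz.
  have := hz z Uz Xz; rewrite (taylorE k oU ha Uz Xz) => e.
  have oXX := zopen2X X.
  have : pp_class X k (taylor_rep a) z (fun=> 0).
    rewrite e; apply: (pp_class_self k oXX) => //.
      by split=> //; apply: zopen_sub Uz.
    exact: sec20.
  move=> [W [oW Wz _ hI]]; exists W; split=> //.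
  apply: Ipow_ext (IpowZ oW (-1) hI) => w _; ring.
have [W [oW Wz hI]] := hz z Uz Xz.
rewrite (taylorE k oU ha Uz Xz); apply: (pp_class_eq oW Wz).
by apply: Ipow_ext hI => w _; rewrite subr0.
Qed.

Lemma VO_sub U U' a : zopen X U' -> U' `<=` U -> VO X U a -> VO X U' a.
Proof. by move=> oU' s h i; apply: sec_sub (h i). Qed.

Lemma ker_sub k U U' a : zopen X U -> zopen X U' -> U' `<=` U ->
  ker_taylor X k U a -> ker_taylor X k U' a.
Proof.
move=> oU oU' s /(kerP _ _ oU) [ha hz]; apply/(kerP _ _ oU'); split.
  exact: VO_sub ha.
by move=> z /s; apply: hz.
Qed.

Lemma ker_ext k U a b : zopen X U -> (forall x, U x -> a x = b x) ->
  ker_taylor X k U a -> ker_taylor X k U b.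
Proof.
move=> oU e /(kerP _ _ oU) [ha hz]; apply/(kerP _ _ oU); split.
  by move=> i; apply: sec_ext (ha i) => x Ux; rewrite e.
move=> z Uz Xz; have [W [oW Wz hI]] := hz z Uz Xz.
have oWW := zopen2I oW (zopen2_pull1 XP oU).
exists (W `&` [set w | U w.1 /\ X w.2]); split=> //.
apply: (@Ipow_ext _ _ (taylor_rep a)); last by apply: Ipow_sub hI => // w [].
by move=> w [_ [/e ew _]]; rewrite /taylor_rep ew.
Qed.

Lemma kerD k U a b : zopen X U -> ker_taylor X k U a -> ker_taylor X k U b ->
  ker_taylor X k U (fun x => a x + b x).
Proof.
move=> oU /(kerP _ _ oU) [ha hz] /(kerP _ _ oU) [hb hz']; apply/(kerP _ _ oU); split.
  by move=> i; apply: sec_ext (secD XP (ha i) (hb i)) => x Ux; rewrite mxE.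
move=> z Uz Xz; have [W [oW Wz hI]] := hz z Uz Xz.
have [W' [oW' Wz' hI']] := hz' z Uz Xz.
have oWW := zopen2I oW oW'.
exists (W `&` W'); split=> //.
have h1 : Ipow k.+1 (W `&` W') (taylor_rep a) by apply: Ipow_sub hI => // w [].
have h2 : Ipow k.+1 (W `&` W') (taylor_rep b) by apply: Ipow_sub hI' => // w [].
apply: Ipow_ext (IpowD h1 h2) => w _.
rewrite /taylor_rep -big_split; apply: eq_bigr => i _; rewrite /= mxE; ring.
Qed.

Lemma kerM k U f a : zopen X U -> sec X 0 U f -> ker_taylor X k U a ->
  ker_taylor X k U (fun x => f x *: a x).
Proof.
move=> oU hf /(kerP _ _ oU) [ha hz]; apply/(kerP _ _ oU); split.
  by move=> i; apply: sec_ext (secM0 XP hf (ha i)) => x Ux; rewrite mxE.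
move=> z Uz Xz; have [W [oW Wz hI]] := hz z Uz Xz.
have oWW := zopen2I oW (zopen2_pull1 XP oU).
exists (W `&` [set w | U w.1 /\ X w.2]); split=> //.
have h1 : Ipow k.+1 (W `&` [set w | U w.1 /\ X w.2]) (taylor_rep a).
  by apply: Ipow_sub hI => // w [].
have h2 : sec2 X 0 0 (W `&` [set w | U w.1 /\ X w.2]) (fun w => f w.1).
  by apply: (sec2_pull1 XP oU hf oWW) => w [_ []].
apply: Ipow_ext (IpowM h2 h1) => w _.
rewrite /taylor_rep mulr_sumr; apply: eq_bigr => i _; rewrite /= mxE; ring.
Qed.

Lemma ker_zero k U : zopen X U -> ker_taylor X k U (fun=> 0).
Proof.
move=> oU; apply/(kerP _ _ oU); split.
  by move=> i; apply: sec_ext (sec0 XP 0 oU) => x Ux; rewrite mxE.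
move=> z Uz Xz; have oW := zopen2_pull1 XP oU.
exists [set w | U w.1 /\ X w.2]; split=> //.
apply: Ipow_ext (Ipow_zero _ _) => w _; rewrite /taylor_rep big1 // => i _.
by rewrite mxE mul0r.
Qed.

Lemma ker_sum k U (I : Type) (s : seq I) (a : I -> pt -> pt) : zopen X U ->
  (forall i, ker_taylor X k U (a i)) ->
  ker_taylor X k U (fun x => \sum_(i <- s) a i x).
Proof.
move=> oU h; elim: s => [|i s IH].
  by apply: ker_ext (ker_zero k oU) => // x _; rewrite big_nil.
by apply: ker_ext (kerD oU (h i) IH) => // x _; rewrite big_cons.
Qed.

Lemma kerS k U a : zopen X U -> ker_taylor X k.+1 U a -> ker_taylor X k U a.
Proof.
move=> oU /(kerP _ _ oU) [ha hz]; apply/(kerP _ _ oU); split=> // z Uz Xz.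
have [W [oW Wz hI]] := hz z Uz Xz; exists W; split=> //; exact: IpowS.
Qed.

Lemma ker_vanish k U a x : zopen X U -> ker_taylor X k U a -> U x ->
  lform (a x) x = 0.
Proof.
move=> oU /(kerP _ _ oU) [ha hz] Ux.
have [W [oW Wz [N [g [l [hg hl /(_ _ Wz) e]]]]]] := hz (x, x) Ux (zopen_sub XP oU Ux).
rewrite -[LHS]/(taylor_rep a (x, x)) e big1 // => j _.
by rewrite big_ord_recl; have [_ ->] := hg j ord0; rewrite ?mul0r.
Qed.

Lemma ker_of_vanish k U a : zopen X U -> VO X U a ->
  (forall x y, U x -> X y -> lform (a x) y = 0) -> ker_taylor X k U a.
Proof.
move=> oU ha h; apply/(kerP _ _ oU); split=> // z Uz Xz.
exists [set w | U w.1 /\ X w.2]; split=> //; first exact: zopen2_pull1.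
apply: Ipow_ext (Ipow_zero _ _) => w [Uw Xw].
by rewrite -[RHS]/(lform (a w.1) w.2) h.
Qed.

End Kernels.

(** * The function field *)

Section FunctionField.
Variables (R : realType) (r : nat).
Notation C := R[i].
Notation pt := 'rV[C]_r.+1.
Notation n := r.+1.
Variable X : set pt.
Hypotheses (XP : X `<=` Pr) (irrX : zirreducible X).

Definition rational (f : pt -> C) :=
  exists U, [/\ zopen X U, U !=set0 & sec X 0 U f].

Definition geneq (f g : pt -> C) :=
  exists U, [/\ zopen X U, U !=set0 & forall x, U x -> f x = g x].

Lemma zopenX0 : X !=set0. Proof. by case: irrX. Qed.

Lemma common_open U U' : zopen X U -> zopen X U' -> U !=set0 -> U' !=set0 ->
  exists V, [/\ zopen X V, V !=set0, V `<=` U & V `<=` U'].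
Proof.
move=> oU oU' U0 U'0; exists (U `&` U'); split.
- exact: (zopenI XP oU oU').
- exact: (zopen_meet irrX oU oU' U0 U'0).
- by move=> x [].
- by move=> x [].
Qed.

Lemma rational2 f g : rational f -> rational g ->
  exists U, [/\ zopen X U, U !=set0, sec X 0 U f & sec X 0 U g].
Proof.
move=> [U [oU U0 hf]] [U' [oU' U'0 hg]].
have [V [oV V0 s s']] := common_open oU oU' U0 U'0.
by exists V; split=> //; [apply: sec_sub hf | apply: sec_sub hg].
Qed.

Lemma geneq_refl f : geneq f f.
Proof. by exists X; split=> //; [apply: zopenX | apply: zopenX0]. Qed.

Lemma geneq_sym f g : geneq f g -> geneq g f.
Proof. by move=> [U [oU U0 e]]; exists U; split=> // x Ux; rewrite e. Qed.

Lemma geneq_op (op : C -> C -> C) f f' g g' : geneq f f' -> geneq g g' ->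
  geneq (fun x => op (f x) (g x)) (fun x => op (f' x) (g' x)).
Proof.
move=> [U [oU U0 e]] [U' [oU' U'0 e']].
have [V [oV V0 s s']] := common_open oU oU' U0 U'0.
by exists V; split=> // x Vx; rewrite e ?e'; [| apply: s'|apply: s].
Qed.

Lemma geneq_trans g f h : geneq f g -> geneq g h -> geneq f h.
Proof.
move=> [U [oU U0 e]] [U' [oU' U'0 e']].
have [V [oV V0 s s']] := common_open oU oU' U0 U'0.
by exists V; split=> // x Vx; rewrite e ?e'; [| apply: s'|apply: s].
Qed.

Lemma rationalC c : rational (fun=> c).
Proof. by exists X; split; [apply: zopenX|apply: zopenX0|apply: secC => //; apply: zopenX]. Qed.

Lemma rationalD f g : rational f -> rational g -> rational (fun x => f x + g x).
Proof.
by move=> hf hg; have [U [oU U0 h h']] := rational2 hf hg; exists U; split=> //; apply: secD.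
Qed.

Lemma rationalM f g : rational f -> rational g -> rational (fun x => f x * g x).
Proof.
by move=> hf hg; have [U [oU U0 h h']] := rational2 hf hg; exists U; split=> //; apply: secM0.
Qed.

Lemma rational_geneq f g : geneq f g -> rational f -> rational g.
Proof.
move=> [U [oU U0 e]] [U' [oU' U'0 h]].
have [V [oV V0 s s']] := common_open oU oU' U0 U'0.
exists V; split=> //; apply: (@sec_ext _ _ _ _ _ f) => [x Vx|]; first by rewrite e //; apply: s.
by apply: sec_sub h.
Qed.

Lemma rationalN f : rational f -> rational (fun x => - f x).
Proof.
move=> hf; have := rationalM (rationalC (-1)) hf; apply: rational_geneq.
exists X; split; [exact: zopenX|exact: zopenX0|move=> x _; ring].
Qed.

Lemma rational_zero_or_inv f : rational f -> geneq f (fun=> 0) \/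
  exists U, [/\ zopen X U, U !=set0, sec X 0 U f & forall x, U x -> f x != 0].
Proof.
move=> [U [oU U0 h]].
have [[x Ux nf]|nh] := pselect (exists2 x, U x & f x != 0); last first.
  left; exists U; split=> // x Ux; apply/eqP; apply: contra_notT nh => nf; by exists x.
have [V [oV Vx s nV]] := sec_nonzero XP oU h Ux nf.
right; exists V; split=> //; [by exists x | exact: sec_sub h].
Qed.

Lemma rationalV f : rational f -> rational (fun x => (f x)^-1).
Proof.
move=> hf; have [f0|[U [oU U0 h nf]]] := rational_zero_or_inv hf.
  apply: rational_geneq (rationalC 0); apply: geneq_sym.
  by move: f0 => [U [oU U0 e]]; exists U; split=> // x Ux; rewrite e // invr0.
exists U; split=> //; have := secV nf h; by rewrite oppr0.
Qed.

Record ratfun := Ratfun { rf :> pt -> C; rfP : rational rf }.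
HB.instance Definition _ := gen_eqMixin ratfun.
HB.instance Definition _ := gen_choiceMixin ratfun.

Definition ratfun_eq : rel ratfun := fun f g => `[< geneq f g >].

Lemma ratfun_eq_refl : reflexive ratfun_eq.
Proof. by move=> f; apply/asboolP; apply: geneq_refl. Qed.
Lemma ratfun_eq_sym : ssrbool.symmetric ratfun_eq.
Proof. by move=> f g; apply/asboolP/asboolP; apply: geneq_sym. Qed.
Lemma ratfun_eq_trans : transitive ratfun_eq.
Proof. by move=> g f h /asboolP h1 /asboolP h2; apply/asboolP; apply: geneq_trans h2. Qed.

Canonical ratfun_equiv := EquivRel ratfun_eq ratfun_eq_refl ratfun_eq_sym ratfun_eq_trans.

Definition funfield := {eq_quot ratfun_eq}%qT.
HB.instance Definition _ := EqQuotient.on funfield.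
HB.instance Definition _ := Choice.on funfield.

Definition germ (f : pt -> C) : funfield :=
  if pselect (rational f) is left h then \pi_funfield%qT (Ratfun h)
  else \pi_funfield%qT (Ratfun (rationalC 0)).

Definition rep (k : funfield) : pt -> C := rf (repr k).

Lemma rep_rational k : rational (rep k).
Proof. exact: rfP. Qed.

Lemma germ_eq f g : rational f -> rational g -> germ f = germ g <-> geneq f g.
Proof.
rewrite /germ => hf hg; case: pselect => // hf'; case: pselect => // hg'.
split=> [/eqP|h]; last by apply/eqP; rewrite piE /=; apply/asboolP.
by rewrite piE => /asboolP.
Qed.

Lemma repK k : germ (rep k) = k.
Proof.
rewrite /germ; case: pselect => [h|]; last by case; apply: rep_rational.
rewrite -[RHS]reprK; apply/eqP; rewrite piE; apply/asboolP; exact: geneq_refl.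
Qed.

Lemma rep_germ f : rational f -> geneq (rep (germ f)) f.
Proof. by move=> hf; apply/germ_eq; rewrite ?repK //; apply: rep_rational. Qed.

Definition fadd (a b : funfield) := germ (fun x => rep a x + rep b x).
Definition fopp (a : funfield) := germ (fun x => - rep a x).
Definition fmul (a b : funfield) := germ (fun x => rep a x * rep b x).
Definition finv (a : funfield) := germ (fun x => (rep a x)^-1).

Lemma fadd_germ f g : rational f -> rational g ->
  fadd (germ f) (germ g) = germ (fun x => f x + g x).
Proof.
move=> hf hg; apply/germ_eq.
- by apply: rationalD; apply: rep_rational.
- exact: rationalD.
- by apply: (geneq_op +%R); apply: rep_germ.
Qed.

Lemma fmul_germ f g : rational f -> rational g ->
  fmul (germ f) (germ g) = germ (fun x => f x * g x).
Proof.
move=> hf hg; apply/germ_eq.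
- by apply: rationalM; apply: rep_rational.
- exact: rationalM.
- by apply: (geneq_op *%R); apply: rep_germ.
Qed.

Lemma fopp_germ f : rational f -> fopp (germ f) = germ (fun x => - f x).
Proof.
move=> hf; apply/germ_eq; [apply: rationalN; exact: rep_rational | exact: rationalN |].
by apply: (geneq_op (fun a _ => - a) (rep_germ hf) (rep_germ hf)).
Qed.

Lemma finv_germ f : rational f -> finv (germ f) = germ (fun x => (f x)^-1).
Proof.
move=> hf; apply/germ_eq; [apply: rationalV; exact: rep_rational | exact: rationalV |].
by apply: (geneq_op (fun a _ => a^-1) (rep_germ hf) (rep_germ hf)).
Qed.

Lemma germP k : exists2 f, rational f & k = germ f.
Proof. by exists (rep k); [apply: rep_rational | rewrite repK]. Qed.

Let RD := rationalD. Let RM := rationalM. Let RN := rationalN. Let RC := rationalC.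

Lemma faddA : associative fadd.
Proof.
move=> a b c; have [f hf ->] := germP a; have [g hg ->] := germP b; have [h hh ->] := germP c.
rewrite !fadd_germ //; try exact: RD.
by congr germ; apply/funext => x; rewrite addrA.
Qed.
Lemma faddC : commutative fadd.
Proof.
move=> a b; have [f hf ->] := germP a; have [g hg ->] := germP b.
by rewrite !fadd_germ //; congr germ; apply/funext => x; rewrite addrC.
Qed.
Lemma fadd0 : left_id (germ (fun=> 0)) fadd.
Proof.
move=> a; have [f hf ->] := germP a.
by rewrite !fadd_germ //; congr germ; apply/funext => x; rewrite add0r.
Qed.
Lemma faddN : left_inverse (germ (fun=> 0)) fopp fadd.
Proof.
move=> a; have [f hf ->] := germP a.
rewrite fopp_germ // fadd_germ //; last exact: RN.
by congr germ; apply/funext => x; rewrite addNr.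
Qed.
HB.instance Definition _ := GRing.isZmodule.Build funfield faddA faddC fadd0 faddN.

Lemma fmulA : associative fmul.
Proof.
move=> a b c; have [f hf ->] := germP a; have [g hg ->] := germP b; have [h hh ->] := germP c.
rewrite !fmul_germ //; try exact: RM.
by congr germ; apply/funext => x; rewrite mulrA.
Qed.
Lemma fmulC : commutative fmul.
Proof.
move=> a b; have [f hf ->] := germP a; have [g hg ->] := germP b.
by rewrite !fmul_germ //; congr germ; apply/funext => x; rewrite mulrC.
Qed.
Lemma fmul1 : left_id (germ (fun=> 1)) fmul.
Proof.
move=> a; have [f hf ->] := germP a.
by rewrite !fmul_germ //; congr germ; apply/funext => x; rewrite mul1r.
Qed.
Lemma fmulD : left_distributive fmul fadd.
Proof.
move=> a b c; have [f hf ->] := germP a; have [g hg ->] := germP b; have [h hh ->] := germP c.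
rewrite [fadd (germ f) _]fadd_germ // (fmul_germ (RD hf hg)) // (fmul_germ hf) // (fmul_germ hg) //.
rewrite fadd_germ //; try exact: RM.
by congr germ; apply/funext => x; rewrite mulrDl.
Qed.
Lemma fone_neq0 : germ (fun=> 1) != 0 :> funfield.
Proof.
apply/eqP => /germ_eq [||U [_ [x Ux] /(_ x Ux) /eqP]]; try exact: RC.
by rewrite oner_eq0.
Qed.
HB.instance Definition _ := GRing.Zmodule_isComNzRing.Build funfield
  fmulA fmulC fmul1 fmulD fone_neq0.

Lemma finvP (a : funfield) : a != 0 -> finv a * a = 1.
Proof.
have [f hf ->] := germP a; have [f0|[U [oU U0 h nf]]] := rational_zero_or_inv hf.
  have -> : germ f = 0 by apply/germ_eq.
  by rewrite eqxx.
move=> _; rewrite finv_germ // -[_ * _]/(fmul _ _) fmul_germ //; last exact: rationalV.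
apply/germ_eq => //; first by apply: rationalM => //; apply: rationalV.
by exists U; split=> // x Ux; rewrite mulVf // nf.
Qed.
Lemma finv0 : finv 0 = 0.
Proof.
rewrite -[0]/(germ (fun=> 0)) finv_germ; last exact: RC.
by congr germ; apply/funext => x; rewrite invr0.
Qed.
HB.instance Definition _ := GRing.ComNzRing_isField.Build funfield finvP finv0.

Lemma germD f g : rational f -> rational g ->
  germ (fun x => f x + g x) = germ f + germ g.
Proof. by move=> hf hg; rewrite -fadd_germ. Qed.
Lemma germM f g : rational f -> rational g ->
  germ (fun x => f x * g x) = germ f * germ g.
Proof. by move=> hf hg; rewrite -fmul_germ. Qed.
Lemma germV f : rational f -> germ (fun x => (f x)^-1) = (germ f)^-1.
Proof. by move=> hf; rewrite -finv_germ. Qed.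

Definition cst (c : C) : funfield := germ (fun=> c).
Lemma cst_is_zmod : zmod_morphism cst.
Proof.
move=> a b; by rewrite /cst -[RHS]/(fadd _ (fopp _)) fopp_germ // fadd_germ.
Qed.
Lemma cst_is_monoid : monoid_morphism cst.
Proof. by split=> // a b; rewrite /cst -germM. Qed.
HB.instance Definition _ := GRing.isZmodMorphism.Build C funfield cst cst_is_zmod.
HB.instance Definition _ := GRing.isMonoidMorphism.Build C funfield cst cst_is_monoid.

Lemma funfield_char0 : [pchar funfield] =i pred0.
Proof. by move=> p; rewrite (fmorph_pchar cst) Num.Theory.pchar_num. Qed.

Lemma germ_sum (I : Type) (s : seq I) (f : I -> pt -> C) :
  (forall i, rational (f i)) ->
  rational (fun x => \sum_(i <- s) f i x) /\
  germ (fun x => \sum_(i <- s) f i x) = \sum_(i <- s) germ (f i).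
Proof.
move=> hf; elim: s => [|i s [IH1 IH2]].
  have -> : (fun x => \sum_(i <- [::]) f i x) = (fun=> 0).
    by apply/funext => x; rewrite big_nil.
  by rewrite big_nil.
have -> : (fun x => \sum_(j <- i :: s) f j x) = (fun x => f i x + \sum_(j <- s) f j x).
  by apply/funext => x; rewrite big_cons.
by split; [apply: rationalD | rewrite germD // IH2 big_cons].
Qed.

Lemma germ_ext U f g : zopen X U -> U !=set0 -> sec X 0 U f ->
  (forall x, U x -> f x = g x) -> germ f = germ g.
Proof.
move=> oU U0 hf e; apply/germ_eq; [by exists U| |by exists U].
by exists U; split=> //; apply: sec_ext hf.
Qed.

Lemma germ_inj U f g : zopen X U -> sec X 0 U f -> sec X 0 U g ->
  germ f = germ g -> forall x, U x -> f x = g x.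
Proof.
move=> oU hf hg e x Ux.
have U0 : U !=set0 by exists x.
move: e => /germ_eq [||V [oV V0 e]]; [by exists U|by exists U|].
apply/eqP; rewrite -subr_eq0; apply/eqP.
apply: (sec_dense XP irrX oU (f := fun x => f x - g x) _ oV V0) => //.
  apply: (@sec_ext _ _ _ _ _ (fun x => f x + -1 * g x)) => [y _|]; first by ring.
  exact: (secD XP hf (secZ XP (-1) oU hg)).
by move=> y Vy _; rewrite e // subrr.
Qed.

Definition regular (k : funfield) (x : pt) :=
  exists U f, [/\ zopen X U, U x, sec X 0 U f & k = germ f].

Definition fval (k : funfield) (x : pt) : C :=
  xget 0 [set c | exists U f, [/\ zopen X U, U x, sec X 0 U f & k = germ f /\ c = f x]].

Lemma fvalE U f x : zopen X U -> U x -> sec X 0 U f -> fval (germ f) x = f x.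
Proof.
move=> oU Ux hf; rewrite /fval; case: xgetP => [c _ [V [g [oV Vx hg [e ->]]]]|/(_ (f x))].
  have oUV := zopenI XP oU oV.
  apply: (germ_inj oUV _ _ (esym e)) => //.
    by apply: sec_sub hg => // y [].
  by apply: sec_sub hf => // y [].
by case; exists U, f.
Qed.

Lemma fvalD k l x : regular k x -> regular l x -> fval (k + l) x = fval k x + fval l x.
Proof.
move=> [U [f [oU Ux hf ->]]] [V [g [oV Vx hg ->]]].
have oUV := zopenI XP oU oV.
have hf' : sec X 0 (U `&` V) f by apply: sec_sub hf => // y [].
have hg' : sec X 0 (U `&` V) g by apply: sec_sub hg => // y [].
have UV0 : (U `&` V) !=set0 by exists x.
rewrite -germD; [|by exists (U `&` V)..].
by rewrite !(@fvalE (U `&` V)) //; apply: secD.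
Qed.

Lemma fvalM k l x : regular k x -> regular l x -> fval (k * l) x = fval k x * fval l x.
Proof.
move=> [U [f [oU Ux hf ->]]] [V [g [oV Vx hg ->]]].
have oUV := zopenI XP oU oV.
have hf' : sec X 0 (U `&` V) f by apply: sec_sub hf => // y [].
have hg' : sec X 0 (U `&` V) g by apply: sec_sub hg => // y [].
have UV0 : (U `&` V) !=set0 by exists x.
rewrite -germM; [|by exists (U `&` V)..].
by rewrite !(@fvalE (U `&` V)) //; apply: secM0.
Qed.

Lemma regularM k l x : regular k x -> regular l x -> regular (k * l) x.
Proof.
move=> [U [f [oU Ux hf ->]]] [V [g [oV Vx hg ->]]].
have oUV := zopenI XP oU oV.
have hf' : sec X 0 (U `&` V) f by apply: sec_sub hf => // y [].
have hg' : sec X 0 (U `&` V) g by apply: sec_sub hg => // y [].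
have UV0 : (U `&` V) !=set0 by exists x.
exists (U `&` V), (fun x => f x * g x); split=> //; first exact: secM0.
by rewrite germM //; exists (U `&` V).
Qed.

End FunctionField.

(** * Derivations of the function field *)

Lemma quotient_rule (F : fieldType) (q p p' g g' h c : F) : g != 0 -> h != 0 ->
  q * (p' * g - p * g') / (h * (g * g)) * (c * g) =
  (c * p' + -1 * (p / g * (c * g'))) * (q / h).
Proof. by move=> ng nh; field; rewrite ng nh. Qed.

Section Derivations.
Variables (R : realType) (r : nat).
Notation C := R[i].
Notation pt := 'rV[C]_r.+1.
Notation n := r.+1.
Variable X : set pt.
Hypotheses (XP : X `<=` Pr) (irrX : zirreducible X).
Variable i0 : 'I_n.
Hypothesis chart0 : basic X 'X_i0 !=set0.
Notation K := (funfield XP irrX).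
Notation germ := (germ XP irrX).
Notation cst := (cst XP irrX).
Notation chart := (basic X 'X_i0).

Definition dehom (x : pt) : pt := (x 0 i0)^-1 *: x.

Lemma chart_neq0 x : chart x -> x 0 i0 != 0.
Proof. by case=> _; rewrite mevalXU. Qed.

Lemma open_chart : zopen X chart.
Proof. exact: zopen_coord. Qed.

Lemma sec_dehom (p : {mpoly C[n]}) : sec X 0 chart (fun x => p.@[dehom x 0]).
Proof.
have oU := open_chart.
elim/mpoly_ring_ind: p => [c|i|p q hp hq|p q hp hq].
- by apply: sec_ext (secC XP c oU) => x _; rewrite mevalC.
- apply: (@sec_ext _ _ _ _ _ (fun x => ('X_i : {mpoly C[n]}).@[x 0] / ('X_i0 : {mpoly C[n]}).@[x 0])).
    by move=> x _; rewrite !mevalXU mxE mulrC.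
  apply: sec_frac (homogX R i) (homogX R i0) _ _ => //.
  by move=> x [].
- by apply: sec_ext (secD XP hp hq) => x _; rewrite mevalD.
- by apply: sec_ext (secM0 XP hp hq) => x _; rewrite mevalM.
Qed.

Definition ev (p : {mpoly C[n]}) : K := germ (fun x => p.@[dehom x 0]).

Lemma ev_rational p : rational X (fun x => p.@[dehom x 0]).
Proof. by exists chart; split=> //; [apply: open_chart | apply: sec_dehom]. Qed.

Lemma evC c : ev c%:MP = cst c.
Proof. by congr germ; apply/funext => x; rewrite mevalC. Qed.
Lemma evD p q : ev (p + q) = ev p + ev q.
Proof.
by rewrite -germD; [congr germ; apply/funext => x; rewrite mevalD|apply: ev_rational..].
Qed.
Lemma evM p q : ev (p * q) = ev p * ev q.
Proof.
by rewrite -germM; [congr germ; apply/funext => x; rewrite mevalM|apply: ev_rational..].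
Qed.

Lemma meval_dehom d (F : {mpoly C[n]}) x : F \is d.-homog ->
  F.@[dehom x 0] = (x 0 i0)^-1 ^+ d * F.@[x 0].
Proof. by move=> hF; apply: (dhomog_meval hF) => i; rewrite mxE. Qed.

Lemma germ_frac (k : K) : exists (d : nat) (F G : {mpoly C[n]}),
  [/\ F \is d.-homog, G \is d.-homog, basic X G !=set0 &
      k = germ (fun x => F.@[x 0] / G.@[x 0])].
Proof.
have [f [U [oU [x Ux] hf]] ->] := germP k.
have [V [oV Vx sV [p [q [F [G [hF hG e FG]]]]]]] := hf x Ux.
have pq : q = p by lia.
rewrite {q}pq in hG e; exists p, F, G; split=> //.
- by exists x; split; [apply: zopen_sub Ux | have [] := FG x Vx].
- apply: (germ_ext XP irrX oV); [by exists x | exact: (sec_sub XP oV sV hf)|].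
  by move=> y /FG [].
Qed.

Lemma ev_frac d (F G : {mpoly C[n]}) : F \is d.-homog -> G \is d.-homog ->
  basic X G !=set0 -> germ (fun x => F.@[x 0] / G.@[x 0]) = ev F / ev G.
Proof.
move=> hF hG G0; rewrite -germV; last exact: ev_rational.
have oG : zopen X (basic X G) by apply: zopen_basic hG.
rewrite -germM; [|exact: ev_rational|apply: rationalV => //; exact: ev_rational].
have [x [Ux Vx]] := zopen_meet irrX open_chart oG chart0 G0.
have oV := zopenI XP open_chart oG.
apply: (germ_ext XP irrX oV); first by exists x.
  apply: (sec_frac oV hF hG); first by rewrite subrr.
  by move=> y [_ []].
move=> y [/chart_neq0 ny [_ nG]]; rewrite (meval_dehom _ hF) (meval_dehom _ hG).
have : (y 0 i0)^-1 ^+ d != 0 by rewrite expf_neq0 // invr_eq0.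
by move: (_ ^+ d) => c nc; field; rewrite nG nc.
Qed.

Lemma funfield_generated (G : K -> K -> Prop) : dgraph cst G ->
  (forall x, x \in [seq ev 'X_i | i : 'I_n] -> exists v, G x v) ->
  forall x, exists v, G x v.
Proof.
move=> dG hG k.
have dom_ev p : exists v, G (ev p) v.
  elim/mpoly_ring_ind: p => [c|i|p q [v hv] [w hw]|p q [v hv] [w hw]].
  - by exists 0; rewrite evC; apply: (dgC dG).
  - by apply: hG; apply: (map_f (fun i => ev 'X_i)); rewrite mem_enum.
  - by exists (v + w); rewrite evD; apply: (dgD dG).
  - by eexists; rewrite evM; apply: (dgM dG hv hw).
have [d [F [H [hF hH H0 ->]]]] := germ_frac k; rewrite (ev_frac hF hH H0).
have [v hv] := dom_ev F; have [w hw] := dom_ev H.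
by eexists; apply: (dgM dG hv (dgV dG hw)).
Qed.

Lemma derivation_ex (f : K) : ~ (exists c, f = cst c) ->
  exists2 D, cderivation cst D & D f != 0.
Proof. by apply: (cderivation_ex _ funfield_generated); apply: funfield_char0. Qed.

Variable D : K -> K.
Hypothesis hD : cderivation cst D.

Let DC c : D (cst c) = 0. Proof. by have [h _ _] := hD; apply: h. Qed.
Let DD a b : D (a + b) = D a + D b. Proof. by have [_ h _] := hD; apply: h. Qed.
Let DM a b : D (a * b) = D a * b + a * D b. Proof. by have [_ _ h] := hD; apply: h. Qed.

Lemma D_ev p : D (ev p) = \sum_i ev p^`M(i) * D (ev 'X_i).
Proof.
have ev0 : ev 0 = 0 by rewrite -mpolyC0 evC rmorph0.
have ev1 : ev 1 = 1 by rewrite -mpolyC1 evC rmorph1.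
elim/mpoly_ring_ind: p => [c|i|p q hp hq|p q hp hq].
- by rewrite evC DC big1 // => i _; rewrite mderivC ev0 mul0r.
- rewrite (bigD1 i) //= big1 ?addr0.
    have mm k (m : 'X_{1..k}) : (m - m)%MM = 0%MM by rewrite -{1}[m]add0m addmK.
    by rewrite mderivX mnm1E eqxx scale1r mm mpolyX0 ev1 mul1r.
  by move=> j ji; rewrite mderivX mnm1E eq_sym (negPf ji) scale0r ev0 mul0r.
- rewrite evD DD hp hq -big_split; apply: eq_bigr => i _ /=.
  by rewrite mderivD evD mulrDl.
- rewrite evM DM hp hq mulr_suml mulr_sumr -big_split; apply: eq_bigr => i _ /=.
  by rewrite mderivM evD !evM mulrDl !mulrA [_ * D _ * ev q]mulrAC.
Qed.

Lemma basic_prod (I : Type) (s : seq I) (d : I -> nat) (G : I -> {mpoly C[n]}) :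
  (forall i, G i \is (d i).-homog) -> (forall i, basic X (G i) !=set0) ->
  basic X (\prod_(i <- s) G i) !=set0.
Proof.
move=> hG G0; suff [_ //] : \prod_(i <- s) G i \is (\sum_(i <- s) d i).-homog /\
  basic X (\prod_(i <- s) G i) !=set0.
elim: s => [|i s [IH1 IH2]].
  rewrite !big_nil; split; first exact: dhomog1.
  have [x Xx] := zopenX0 irrX; exists x; split=> //; by rewrite meval1 oner_neq0.
rewrite !big_cons; split; first exact: dhomogM.
have [x [[Xx n1] [_ n2]]] := zopen_meet irrX (zopen_basic XP (hG i)) (zopen_basic XP IH1) (G0 i) IH2.
by exists x; split=> //; rewrite mevalM mulf_neq0.
Qed.

Lemma common_denominator (I : finType) (k : I -> K) :
  exists (d : nat) (F : I -> {mpoly C[n]}) (G : {mpoly C[n]}),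
  [/\ forall i, F i \is d.-homog, G \is d.-homog, basic X G !=set0 &
      forall i, k i = germ (fun x => (F i).@[x 0] / G.@[x 0])].
Proof.
have /choice [d] := fun i => germ_frac (k i).
move=> /choice [F] /choice [G h].
exists (\sum_i d i)%N, (fun i => F i * \prod_(j | j != i) G j), (\prod_i G i).
have hG i : G i \is (d i).-homog by case: (h i).
have hP : \prod_i G i \is (\sum_i d i).-homog by apply: dhomog_prod_ord.
have P0 : basic X (\prod_i G i) !=set0 by apply: basic_prod hG _ => i; case: (h i).
have hF i : F i * \prod_(j | j != i) G j \is (\sum_i d i).-homog.
  have -> : (\sum_i d i = d i + \sum_(j | j != i) d j)%N by rewrite (bigD1 i).
  apply: dhomogM; first by case: (h i).
  elim/big_ind2: _ => [|p a q b|j _]; [exact: dhomog1 | exact: dhomogM | exact: hG].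
split=> //.
- move=> i; have [_ _ _ ->] := h i.
  apply/esym; apply: (germ_ext XP irrX (zopen_basic XP hP) P0).
    apply: (sec_frac (zopen_basic XP hP) (hF i) hP).
    + by rewrite subrr.
    + by move=> x [].
  move=> x [Xx]; rewrite (bigD1 i) //= !mevalM mulf_eq0 negb_or => /andP [n1 n2].
  by field; rewrite n1 n2.
Qed.

Variables (N : nat) (Q : 'I_n -> {mpoly C[n]}) (Gd : {mpoly C[n]}).
Hypotheses (hQ : forall i, Q i \is N.-homog) (hGd : Gd \is N.-homog).
Hypothesis Gd0 : basic X Gd !=set0.
Hypothesis DQ : forall i, D (ev 'X_i) = germ (fun x => (Q i).@[x 0] / Gd.@[x 0]).

(* The open set where the vector field D has no pole. *)
Definition dom := chart `&` basic X Gd.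

Lemma open_dom : zopen X dom.
Proof. by apply: zopenI => //; [apply: open_chart | apply: zopen_basic hGd]. Qed.

Lemma dom_neq0 : dom !=set0.
Proof. exact: (zopen_meet irrX open_chart (zopen_basic XP hGd) chart0 Gd0). Qed.

Definition Dnum (F G : {mpoly C[n]}) :=
  \sum_i Q i * ('X_i0 * F^`M(i) * G - F * ('X_i0 * G^`M(i))).
Definition Dden (G : {mpoly C[n]}) := Gd * (G * G).

Lemma DdenE G x : (Dden G).@[x] = Gd.@[x] * (G.@[x] * G.@[x]).
Proof. by rewrite /Dden !mevalM. Qed.

Lemma DnumE F G x : (Dnum F G).@[x] = \sum_i (Q i).@[x] *
  (('X_i0 * F^`M(i)).@[x] * G.@[x] - F.@[x] * ('X_i0 * G^`M(i)).@[x]).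
Proof.
rewrite /Dnum (raddf_sum (meval x)); apply: eq_bigr => i _ /=.
by rewrite mevalM mevalB mevalM (mevalM x F).
Qed.

Lemma Dnum_homog d F G : F \is d.-homog -> G \is d.-homog ->
  Dnum F G \is (N + (d + d)).-homog.
Proof.
move=> hF hG; apply: rpred_sum => i _; apply: (dhomogM (hQ i)).
apply: rpredB; apply: dhomogM => //.
  by apply: dhomog_deriv => //=; rewrite !mdeg1.
by apply: dhomog_deriv => //=; rewrite !mdeg1.
Qed.

Lemma D_germ d (F G : {mpoly C[n]}) V f : zopen X V -> V !=set0 -> V `<=` dom ->
  F \is d.-homog -> G \is d.-homog ->
  (forall x, V x -> G.@[x 0] != 0 /\ f x = F.@[x 0] / G.@[x 0]) ->
  sec X 0 V (fun x => (Dnum F G).@[x 0] / (Dden G).@[x 0]) /\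
  D (germ f) = germ (fun x => (Dnum F G).@[x 0] / (Dden G).@[x 0]).
Proof.
move=> oV V0 sV hF hG FG.
have nG x : V x -> G.@[x 0] != 0 by move=> /FG [].
have nGd x : V x -> Gd.@[x 0] != 0 by move=> /sV [_ []].
have nx x : V x -> x 0 i0 != 0 by move=> /sV [/chart_neq0].
have hden : Dden G \is (N + (d + d)).-homog by do 2!apply: dhomogM => //.
have nden x : V x -> (Dden G).@[x 0] != 0.
  by move=> Vx; rewrite !mevalM !mulf_neq0 ?nG ?nGd.
have sres : sec X 0 V (fun x => (Dnum F G).@[x 0] / (Dden G).@[x 0]).
  by apply: (sec_frac oV (Dnum_homog hF hG) hden) => //; rewrite subrr.
split=> //.
have sf : sec X 0 V f.
  apply: (@sec_ext _ _ _ _ _ (fun x => F.@[x 0] / G.@[x 0])).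
    by move=> x /FG [].
  by apply: (sec_frac oV hF hG) => //; rewrite subrr.
have rat h : sec X 0 V h -> rational X h by move=> sh; exists V.
have sev p : sec X 0 V (fun x => p.@[dehom x 0]).
  by apply: sec_sub (sec_dehom p) => // x /sV [].
have GE : ev G != 0.
  have [x Vx] := V0; apply/eqP => e; have := nG x Vx.
  have := germ_inj oV (sev G) (secC XP 0 oV) e Vx.
  rewrite (meval_dehom _ hG) => /eqP; rewrite mulf_eq0 expf_eq0 invr_eq0.
  by rewrite (negPf (nx x Vx)) andbF => /eqP ->; rewrite eqxx.
have fG : germ f * ev G = ev F.
  rewrite -germM; [|exact: rat|exact: ev_rational].
  apply: (germ_ext XP irrX oV V0); first exact: secM0.
  move=> x Vx; have [_ ->] := FG x Vx; rewrite (meval_dehom _ hG) (meval_dehom _ hF).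
  by field; rewrite nG // nx.
have Df : D (germ f) * ev G = D (ev F) - germ f * D (ev G).
  by rewrite -fG DM addrK.
apply: (mulIf GE); rewrite {}Df !D_ev mulr_sumr -sumrB.
pose t i x := ((F^`M(i)).@[dehom x 0] + -1 * (f x * (G^`M(i)).@[dehom x 0])) *
   ((Q i).@[x 0] / Gd.@[x 0]).
have sQ i : sec X 0 V (fun x => (Q i).@[x 0] / Gd.@[x 0]).
  by apply: (sec_frac oV (hQ i) hGd) => //; rewrite subrr.
have st i : sec X 0 V (t i).
  by apply: secM0 => //; apply: secD => //; apply: secM0 => //;
     [apply: secC | apply: secM0].
have et i : ev F^`M(i) * D (ev 'X_i) - germ f * (ev G^`M(i) * D (ev 'X_i)) = germ (t i).
  have s1 : sec X 0 V (fun x => f x * (G^`M(i)).@[dehom x 0]) by apply: secM0.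
  have s2 : sec X 0 V (fun x => -1 * (f x * (G^`M(i)).@[dehom x 0])).
    exact: (secM0 XP (secC XP (-1) oV) s1).
  rewrite /t germM; [|apply: rat; apply: secD => //|exact: rat].
  rewrite germD; [|exact: rat|exact: rat].
  rewrite germM; [|apply: rat; exact: secC|exact: rat].
  rewrite germM; [|exact: rat|exact: rat].
  by rewrite -DQ -[germ (fun=> -1)]/(cst (-1)) rmorphN1 -/(ev _) -/(ev _) mulN1r mulrBl mulrA.
rewrite (eq_bigr (fun i => germ (t i))) => [|i _]; last exact: et.
have [_ <-] := germ_sum XP irrX (index_enum _) (fun i => rat _ (st i)).
rewrite -germM; [|exact: rat|exact: ev_rational].
apply/esym; apply: (germ_ext XP irrX oV V0); first exact: secM0.
move=> x Vx; rewrite (meval_dehom _ hG) DnumE DdenE.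
rewrite mulr_suml mulr_suml; apply: eq_bigr => i _.
have hA (H : {mpoly C[n]}) : H \is d.-homog ->
    (H^`M(i)).@[dehom x 0] = (x 0 i0)^-1 ^+ d * ('X_i0 * H^`M(i)).@[x 0].
  move=> hH; rewrite -meval_dehom; last by apply: dhomog_deriv => //=; rewrite !mdeg1.
  by rewrite [in RHS]mevalM mevalXU mxE mulVf ?mul1r // nx.
rewrite /t (hA F) // (hA G) //.
have [_ ->] := FG x Vx.
by apply: quotient_rule; [apply: nG | apply: nGd].
Qed.

Lemma D_regular U f x : zopen X U -> sec X 0 U f -> U x -> dom x ->
  regular (D (germ f)) x.
Proof.
move=> oU hf Ux dx; have [V [oV Vx sV [p [q [F [G [hF hG e FG]]]]]]] := hf x Ux.
have pq : q = p by lia.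
rewrite {q}pq in hG e; have oVd := zopenI XP oV open_dom.
have [|||s ->] := @D_germ p F G (V `&` dom) f oVd _ _ hF hG _.
- by exists x.
- by move=> y [].
- by move=> y [/FG].
by exists (V `&` dom); eexists; split; [| |exact: s|].
Qed.

Lemma sec_D U f : zopen X U -> sec X 0 U f -> U `<=` dom ->
  sec X 0 U (fval (D (germ f))).
Proof.
move=> oU hf sU; apply: sec_local => x Ux.
have [V [g [oV Vx hg ->]]] := D_regular oU hf Ux (sU _ Ux).
have oUV := zopenI XP oU oV.
exists (U `&` V); split=> //.
have sg : sec X 0 (U `&` V) g by apply: sec_sub hg => // y [].
apply: (sec_ext _ sg) => y Uy; by rewrite (fvalE XP irrX oUV Uy sg).
Qed.

(* D acting on the first factor of X x X. *)
Definition D1 (g : pt * pt -> C) (z : pt * pt) : C :=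
  fval (D (germ (fun x => g (x, z.2)))) z.1.

Section Fixed.
Variable W : set (pt * pt).
Hypotheses (oW : zopen2 X W) (sW : forall z, W z -> dom z.1).

Lemma slice_regular e g z : sec2 X 0 e W g -> W z ->
  regular (germ (fun x => g (x, z.2))) z.1 /\
  fval (germ (fun x => g (x, z.2))) z.1 = g z.
Proof.
case: z => x y hg Wz /=; have oy := zopen_slice XP y oW.
have sg := sec2_slice XP (y := y) oW hg.
split; first by exists [set x | W (x, y)], (fun x => g (x, y)).
by rewrite (fvalE XP irrX oy _ sg).
Qed.

Lemma slice_D_regular e g z : sec2 X 0 e W g -> W z ->
  regular (D (germ (fun x => g (x, z.2)))) z.1.
Proof.
case: z => x y hg Wz /=; have oy := zopen_slice XP y oW.
exact: (D_regular oy (sec2_slice XP (y := y) oW hg) Wz (sW Wz)).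
Qed.

Lemma rational_slice e g z : sec2 X 0 e W g -> W z ->
  rational X (fun x => g (x, z.2)).
Proof.
case: z => x y hg Wz /=.
exists [set x | W (x, y)]; split; [exact: zopen_slice|by exists x|exact: sec2_slice hg].
Qed.

Lemma D1M e g h z : sec2 X 0 0 W g -> sec2 X 0 e W h -> W z ->
  D1 (fun w => g w * h w) z = D1 g z * h z + g z * D1 h z.
Proof.
move=> hg hh Wz; rewrite /D1 /=.
rewrite germM; [|exact: rational_slice hg Wz|exact: rational_slice hh Wz].
have [r1 e1] := slice_regular hg Wz; have [r2 e2] := slice_regular hh Wz.
have r3 := slice_D_regular hg Wz; have r4 := slice_D_regular hh Wz.
rewrite DM fvalD; [|exact: regularM|exact: regularM].
by rewrite !fvalM // e1 e2.
Qed.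

Lemma D1D e g h z : sec2 X 0 e W g -> sec2 X 0 e W h -> W z ->
  D1 (fun w => g w + h w) z = D1 g z + D1 h z.
Proof.
move=> hg hh Wz; rewrite /D1 /=.
rewrite germD; [|exact: rational_slice hg Wz|exact: rational_slice hh Wz].
by rewrite DD fvalD; [|exact: slice_D_regular hg Wz|exact: slice_D_regular hh Wz].
Qed.

Lemma D1_ext e g h z : sec2 X 0 e W g -> (forall w, W w -> g w = h w) -> W z ->
  D1 g z = D1 h z.
Proof.
case: z => x y hg gh Wz; rewrite /D1 /=.
have oy := zopen_slice XP y oW.
rewrite (@germ_ext _ _ _ XP irrX _ (fun x => g (x, y)) (fun x => h (x, y)) oy) //.
- by exists x.
- exact: sec2_slice hg.
- by move=> x' /gh.
Qed.

Lemma D1_sum (I : Type) (s : seq I) (g : I -> pt * pt -> C) z :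
  (forall i, sec2 X 0 1 W (g i)) -> W z ->
  sec2 X 0 1 W (fun w => \sum_(i <- s) g i w) /\
  D1 (fun w => \sum_(i <- s) g i w) z = \sum_(i <- s) D1 (g i) z.
Proof.
move=> hg Wz; elim: s => [|i s [IH1 IH2]].
  have -> : (fun w => \sum_(i <- [::]) g i w) = (fun=> 0).
    by apply/funext => w; rewrite big_nil.
  split; first exact: sec20.
  rewrite big_nil /D1 -[germ _]/(cst 0) DC.
  rewrite -(rmorph0 cst) (fvalE XP irrX (zopenX XP)) //.
    by have [] := zopen2_sub oW Wz.
  by apply: secC => //; apply: zopenX.
have -> : (fun w => \sum_(j <- i :: s) g j w) = (fun w => g i w + \sum_(j <- s) g j w).
  by apply/funext => w; rewrite big_cons.
by split; [apply: sec2D | rewrite (D1D (hg i) IH1 Wz) IH2 big_cons].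
Qed.

Definition Dnum2 (F G : {mpoly C[n + n]}) := \sum_i pull1 (Q i) *
  ('X_(lshift n i0) * F^`M(lshift n i) * G - F * ('X_(lshift n i0) * G^`M(lshift n i))).
Definition Dden2 (G : {mpoly C[n + n]}) := pull1 Gd * (G * G).

Lemma bieval_Dden2 G x y : bieval (Dden2 G) (x, y) = (Dden (slice y G)).@[x 0].
Proof. by rewrite DdenE /Dden2 !bievalM bieval_pull1 !meval_slice. Qed.

Lemma bieval_Dnum2 F G x y :
  bieval (Dnum2 F G) (x, y) = (Dnum (slice y F) (slice y G)).@[x 0].
Proof.
rewrite DnumE /Dnum2 bieval_sum; apply: eq_bigr => i _.
rewrite bievalM bievalD bievalN bieval_pull1 /= -!slice_deriv -!(sliceXl y) -!sliceM.
by rewrite !meval_slice !bievalM.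
Qed.

Lemma sec2_D1 e g : sec2 X 0 e W g -> sec2 X 0 e W (D1 g).
Proof.
move=> hg; apply/sec2E => -[x y] Wz.
move/sec2E : (hg) => /(_ _ Wz) [V [oV Vz sV [_ [_ [[p [q [q' [F [G [hF hG e' -> ->]]]]]] FG]]]]].
exists V; split=> //; exists (bieval (Dnum2 F G)), (bieval (Dden2 G)); split.
  exists (N + (p + p))%N, (q + q')%N, (q' + q')%N, (Dnum2 F G), (Dden2 G); split=> //.
  - apply: bihomog_sum => i; rewrite -[(q + q')%N]add0n.
    apply: bihomogM; first exact: bihomog_pull1.
    apply: bihomogD; first by apply: bihomogM => //; apply: bihomog_deriv.
    by apply/bihomogN/bihomogM => //; apply: bihomog_deriv.
  - rewrite /Dden2 -[(q' + q')%N]add0n.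
    by apply: bihomogM; [exact: bihomog_pull1 | exact: bihomogM].
  - lia.
move=> [x' y'] Vz'; have oy := zopen_slice XP y' oV.
have nG : bieval G (x', y') != 0 by have [] := FG _ Vz'.
have V0 : [set x | V (x, y')] !=set0 by exists x'.
have sVd : [set x | V (x, y')] `<=` dom by move=> x1 /= /sV /sW.
have rep1 x1 : V (x1, y') -> (slice y' G).@[x1 0] != 0 /\
    g (x1, y') = (slice y' F).@[x1 0] / (slice y' G).@[x1 0].
  by move=> /FG; rewrite !meval_slice.
have [s eD] := D_germ oy V0 sVd (slice_homog y' hF) (slice_homog y' hG) rep1.
split.
  by rewrite /Dden2 !bievalM !mulf_neq0 ?bieval_pull1 //; have [_ []] := sW (sV _ Vz').
by rewrite /D1 /= eD (fvalE XP irrX oy _ s) // bieval_Dnum2 bieval_Dden2.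
Qed.

Lemma Ipow_D1_single d (g : 'I_d -> pt * pt -> C) l :
  (forall i, diag_ideal X W (g i)) -> sec2 X 0 1 W l ->
  Ipow X d.-1 W (D1 (fun w => (\prod_i g i w) * l w)).
Proof.
elim: d g => [|d IH] g hg hl.
  apply: Ipow_single => //; apply: sec2_D1.
  by apply: sec2_ext hl => w _; rewrite big_ord0 mul1r.
pose h w := (\prod_(i < d) g (lift ord0 i) w) * l w.
have hh : Ipow X d W h.
  exists 1%N, (fun _ i => g (lift ord0 i)), (fun=> l); split=> // w _.
  by rewrite big_ord1.
have sh := Ipow_sec oW hh.
have [sg _] := hg ord0.
have s1 : sec2 X 0 1 W (fun w => g ord0 w * h w) by apply: sec2M.
apply: (@Ipow_ext _ _ _ _ _ (fun w => D1 (g ord0) w * h w + g ord0 w * D1 h w)).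
  move=> w Ww; rewrite -(D1M sg sh Ww); apply: D1_ext s1 _ Ww => v _.
  by rewrite /h big_ord_recl mulrA.
apply: IpowD; first by apply: IpowM => //; apply: sec2_D1.
case: d g hg IH @h hh sh s1 sg => [|d] g hg IH h hh sh s1 sg.
  by apply: Ipow_single => //; apply: sec2M => //; apply: sec2_D1.
by apply: Ipow_mulI => //; apply: IH.
Qed.

Lemma Ipow_D1 d h : Ipow X d.+1 W h -> Ipow X d W (D1 h).
Proof.
move=> hI; have sh := Ipow_sec oW hI.
case: hI => N' [g [l [hg hl e]]].
have term j : Ipow X d.+1 W (fun w => (\prod_i g j i w) * l j w).
  by exists 1%N, (fun _ => g j), (fun=> l j); split=> // w _; rewrite big_ord1.
apply: (@Ipow_ext _ _ _ _ _ (fun w => \sum_j D1 (fun w => (\prod_i g j i w) * l j w) w)).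
  move=> w Ww; rewrite (D1_ext sh e Ww).
  by have [_ ->] := D1_sum (index_enum _) (fun j => Ipow_sec oW (term j)) Ww.
by apply: Ipow_sum => j; apply: (@Ipow_D1_single d.+1).
Qed.

End Fixed.

Definition Dvec (a : pt -> pt) (x : pt) : pt :=
  \row_i fval (D (germ (fun y => a y 0 i))) x.

Lemma Dvec_ker k U a : zopen X U -> U `<=` dom -> ker_taylor X k.+1 U a ->
  ker_taylor X k U (Dvec a).
Proof.
move=> oU sU /(kerP XP _ _ oU) [ha hz]; apply/(kerP XP _ _ oU); split.
  move=> i; apply: sec_ext (sec_D oU (ha i) sU) => x _; by rewrite mxE.
move=> z Uz Xz; have [W' [oW' Wz' hI']] := hz z Uz Xz.
have oW := zopen2I oW' (zopen2_pull1 XP oU); set W := _ `&` _ in oW.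
have Wz : W z by [].
have hI : Ipow X k.+2 W (taylor_rep a) by apply: Ipow_sub hI' => // w [].
have sW w : W w -> dom w.1 by move=> [_ [/sU]].
exists W; split=> //; apply: (Ipow_ext _ (Ipow_D1 oW sW hI)) => w Ww.
have sa i : sec2 X 0 0 W (fun w => a w.1 0 i).
  by apply: (sec2_pull1 (f := fun x => a x 0 i) XP oU (ha i) oW) => v [_ []].
have sc i : sec2 X 0 1 W (fun w => w.2 0 i) by apply: sec2_coord.
have [_ ->] := D1_sum oW sW (index_enum _) (fun i => sec2M (sa i) (sc i)) Ww.
apply: eq_bigr => i _; rewrite (D1M oW sW (sa i) (sc i) Ww) mxE.
have -> : D1 (fun w => w.2 0 i) w = 0.
  rewrite /D1 /= -[germ _]/(cst (w.2 0 i)) DC -(rmorph0 cst).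
  rewrite (fvalE XP irrX (zopenX XP)) //; last by apply: secC => //; apply: zopenX.
  by have [] := zopen2_sub oW Ww.
by rewrite mulr0 addr0.
Qed.

End Derivations.

(** * Ranks and the stable kernel *)

Section LinearAlgebra.
Variables (K : fieldType) (n : nat).

Lemma subspace_mx (E : 'rV[K]_n -> Prop) :
  E 0 -> (forall u v, E u -> E v -> E (u + v)) -> (forall a v, E v -> E (a *: v)) ->
  exists M : 'M_n, forall v, E v <-> (v <= M)%MS.
Proof.
move=> E0 ED EZ.
pose inE (M : 'M_n) := forall v : 'rV_n, (v <= M)%MS -> E v.
pose Q c := `[< exists2 M, inE M & \rank M = c >].
have Q0 : exists c, Q c.
  exists 0%N; apply/asboolP; exists 0; last by rewrite mxrank0.
  by move=> v; rewrite submx0 => /eqP ->.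
have Qn c : Q c -> (c <= n)%N by move=> /asboolP [M _ <-]; apply: rank_leq_row.
case: (ex_maxnP Q0 Qn) => c /asboolP [M hM rM] maxc.
exists M => v; split=> [Ev|]; last exact: hM.
have hMv : inE (M + v)%MS.
  move=> w /sub_addsmxP [[u1 u2] ->]; apply: ED; first by apply: hM; apply: submxMl.
  by rewrite [u2]mx11_scalar mul_scalar_mx; apply: EZ.
have sub : (M <= M + v)%MS by apply: addsmxSl.
have le : (\rank (M + v)%MS <= \rank M)%N.
  by rewrite rM; apply: maxc; apply/asboolP; exists (M + v)%MS.
have := mxrank_leqif_eq sub => -[le1 e1].
have : (M == M + v)%MS by rewrite -e1 eqn_leq le1 le.
by move=> /eqmxP h; apply: submx_trans (addsmxSr M v) _; rewrite -h.
Qed.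

Lemma row_subspaceP (E : 'rV[K]_n -> Prop) (M : 'M_n) m (A : 'M_(m, n)) :
  (forall v, E v <-> (v <= M)%MS) -> (forall i, E (row i A)) -> (A <= M)%MS.
Proof. by move=> h hA; apply/row_subP => i; apply/h. Qed.

Lemma normalized_basis c (B : 'M[K]_(c, n)) : row_free B ->
  exists (f : 'I_c -> 'I_n) (B' : 'M_(c, n)), colsub f B' = 1%:M /\ (B' :=: B)%MS.
Proof.
move=> freeB; have fullB : row_full B^T by rewrite /row_full mxrank_tr.
pose f := fullrankfun fullB; exists f.
have unitP : colsub f B \in unitmx.
  by rewrite -unitmx_tr trmx_mxsub; apply: fullrowsub_unit.
exists (invmx (colsub f B) *m B); split; first by rewrite -mulmx_colsub mulVmx.
by apply: eqmxMfull; rewrite row_full_unit unitmx_inv.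
Qed.

End LinearAlgebra.

Section Main.
Variables (R : realType) (r : nat).
Notation C := R[i].
Notation pt := 'rV[C]_r.+1.
Notation n := r.+1.
Variable X : set pt.
Hypotheses (XP : X `<=` Pr) (irrX : zirreducible X).

Lemma ker_local k U a : zopen X U -> (forall x, U x -> exists V,
  [/\ zopen X V, V x, V `<=` U & ker_taylor X k V a]) -> ker_taylor X k U a.
Proof.
move=> oU h; apply/(kerP XP _ _ oU); split.
  move=> i; apply: sec_local => x /h [V [oV Vx sV /(kerP XP _ _ oV) [ha _]]].
  by exists V; split=> //; apply: ha.
move=> z Uz Xz; have [V [oV Vx sV /(kerP XP _ _ oV) [_ hz]]] := h _ Uz.
exact: hz.
Qed.

Lemma sec_coord i U : zopen X U -> sec X 1 U (fun x => x 0 i).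
Proof.
move=> oU; have := sec_frac (d := 1) oU (homogX R i) (dhomog1 _ mdeg).
move=> /(_ (subr0 _)) h; apply: sec_ext (h _) => x _; first by rewrite mevalXU meval1 divr1.
by rewrite meval1 oner_neq0.
Qed.

Lemma sec_coordV i U : zopen X U -> (forall x, U x -> x 0 i != 0) ->
  sec X (-1) U (fun x => (x 0 i)^-1).
Proof. by move=> oU nU; apply: secV => //; apply: sec_coord. Qed.

Lemma ker_Rsheaf k U a i : zopen X U -> (forall x, U x -> x 0 i != 0) ->
  ker_taylor X k U a -> Rsheaf X k U (fun x => (x 0 i)^-1 *: a x).
Proof.
move=> oU nU ha x Ux; exists U; split=> //.
exists 1%N, (fun _ x => (x 0 i)^-1), (fun=> a); split=> //.
  by move=> _; apply: sec_coordV.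
by move=> y _; rewrite big_ord1.
Qed.

Lemma Rsheaf_ker k U s i : zopen X U -> Rsheaf X k U s ->
  ker_taylor X k U (fun x => x 0 i *: s x).
Proof.
move=> oU hs; apply: ker_local => // x Ux.
have [V [oV Vx sV [N [t [f [ht hf e]]]]]] := hs x Ux.
exists V; split=> //.
have h : ker_taylor X k V (fun x => \sum_j (x 0 i * t j x) *: f j x).
  apply: ker_sum => // j; apply: kerM => //.
  exact: (secM XP (sec_coord i oV) (ht j)).
apply: (ker_ext XP oV _ h) => y Vy; rewrite e // scaler_sumr.
by apply: eq_bigr => j _; rewrite scalerA.
Qed.

Lemma twist_RsheafE k U s : zopen X U ->
  twist X (Rsheaf X k) 1 U s <-> ker_taylor X k U s.
Proof.
move=> oU; split=> h.
  apply: ker_local => // x Ux; have [i Vx'] := coord_basic XP (zopen_sub XP oU Ux).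
  have [V [oV Vx sV [N [t [f [ht hf e]]]]]] := h x Ux.
  have oVi := zopenI XP oV (zopen_coord XP i).
  have nV y : (V `&` basic X 'X_i) y -> y 0 i != 0 by move=> [_ [_]]; rewrite mevalXU.
  exists (V `&` basic X 'X_i); split=> //; first by move=> y [/sV].
  have hk : ker_taylor X k (V `&` basic X 'X_i)
      (fun x => \sum_j (t j x * (x 0 i)^-1) *: (x 0 i *: f j x)).
    apply: ker_sum => // j; apply: kerM => //.
      apply: (secM XP (d := 1) (e := -1)); last exact: sec_coordV.
      by apply: sec_sub (ht j) => // y [].
    have hfj := Rsheaf_ker i oV (hf j).
    by apply: (ker_sub XP oV oVi _ hfj) => y [].
  apply: (ker_ext XP oVi _ hk) => y Vy; rewrite e; last by case: Vy.
  by apply: eq_bigr => j _; rewrite scalerA mulfVK // nV.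
move=> x Ux; have [i Vx] := coord_basic XP (zopen_sub XP oU Ux).
have oVi := zopenI XP oU (zopen_coord XP i).
have nV y : (U `&` basic X 'X_i) y -> y 0 i != 0 by move=> [_ [_]]; rewrite mevalXU.
exists (U `&` basic X 'X_i); split=> //.
exists 1%N, (fun _ (x : pt) => x 0 i), (fun _ (x : pt) => (x 0 i)^-1 *: s x); split.
- by move=> _; apply: sec_coord.
- move=> _; apply: ker_Rsheaf => //.
  by apply: (ker_sub XP oU oVi _ h) => y [].
- by move=> y /nV ny; rewrite big_ord1 scalerA mulfV // scale1r.
Qed.

Notation K := (funfield XP irrX).
Notation germ := (germ XP irrX).
Notation cst := (cst XP irrX).

Lemma common_open_fin (I : finType) (U : I -> set pt) :
  (forall i, zopen X (U i)) -> (forall i, U i !=set0) ->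
  exists V, [/\ zopen X V, V !=set0 & forall i, V `<=` U i].
Proof.
move=> oU U0; have [V [oV V0 sV]] : exists V, [/\ zopen X V, V !=set0 &
    forall i, i \in enum I -> V `<=` U i].
  elim: (enum I) => [|i s [V [oV V0 sV]]].
    by exists X; split=> //; [apply: zopenX | apply: zopenX0].
  have [V' [oV' V'0 s1 s2]] := common_open XP irrX oV (oU i) V0 (U0 i).
  exists V'; split=> // j; rewrite inE => /predU1P [-> //|/sV h].
  exact: subset_trans h.
by exists V; split=> // i; apply: sV; rewrite mem_enum.
Qed.

Lemma germ_lincomb (I : Type) (s : seq I) U (a f : I -> pt -> C) :
  zopen X U -> U !=set0 -> (forall i, sec X 0 U (a i)) -> (forall i, sec X 0 U (f i)) ->
  germ (fun x => \sum_(i <- s) a i x * f i x) = \sum_(i <- s) germ (a i) * germ (f i).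
Proof.
move=> oU U0 ha hf.
have rat i : rational X (fun x => a i x * f i x) by exists U; split=> //; apply: secM0.
have [_ ->] := germ_sum XP irrX s rat.
by apply: eq_bigr => i _; rewrite germM //; exists U.
Qed.

Definition vgerm (a : pt -> pt) : 'rV[K]_n := \row_i germ (fun x => a x 0 i).

Definition generic_ker (k : nat) (v : 'rV[K]_n) : Prop := exists U a,
  [/\ zopen X U, U !=set0, ker_taylor X k U a & v = vgerm a].

Lemma ker_sec k U a i : zopen X U -> ker_taylor X k U a -> sec X 0 U (fun x => a x 0 i).
Proof. by move=> oU /(kerP XP _ _ oU) [ha _]; apply: ha. Qed.

Lemma generic_ker_subspace k : exists M : 'M_n, forall v, generic_ker k v <-> (v <= M)%MS.
Proof.
apply: subspace_mx.
- exists X, (fun=> 0); split; [exact: zopenX|exact: zopenX0|by apply: ker_zero => //; apply: zopenX|].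
  by apply/rowP => i; rewrite !mxE -[LHS](rmorph0 cst); congr germ; apply/funext => x; rewrite mxE.
- move=> _ _ [U [a [oU U0 ha ->]]] [V [b [oV V0 hb ->]]].
  have [W [oW W0 s1 s2]] := common_open XP irrX oU oV U0 V0.
  have ha' := ker_sub XP oU oW s1 ha; have hb' := ker_sub XP oV oW s2 hb.
  exists W, (fun x => a x + b x); split=> //; first exact: kerD.
  apply/rowP => i; rewrite !mxE -germD; [|by exists W; split=> //; apply: ker_sec (_ : ker_taylor X k W _)..].
  by congr germ; apply/funext => x; rewrite mxE.
- move=> l _ [U [a [oU U0 ha ->]]].
  have [f [V [oV V0 hf]] ->] := germP l.
  have [W [oW W0 s1 s2]] := common_open XP irrX oU oV U0 V0.
  have ha' := ker_sub XP oU oW s1 ha; have hf' := sec_sub XP oW s2 hf.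
  exists W, (fun x => f x *: a x); split=> //; first exact: kerM.
  apply/rowP => i; rewrite !mxE -germM; [|by exists W|by exists W; split=> //; apply: ker_sec ha'].
  by congr germ; apply/funext => x; rewrite mxE.
Qed.

Lemma generic_kerS k v : generic_ker k.+1 v -> generic_ker k v.
Proof. by move=> [U [a [oU U0 ha ->]]]; exists U, a; split=> //; apply: kerS. Qed.

Lemma chart_ex : exists i, basic X 'X_i !=set0.
Proof.
have [x Xx] := zopenX0 irrX; have [i hi] := coord_basic XP Xx.
by exists i, x.
Qed.

Lemma germ_fval (k : K) : germ (fval k) = k.
Proof.
have [f [U [oU U0 hf]] ->] := germP k.
apply/esym; apply: (germ_ext XP irrX oU U0 hf) => x Ux.
by rewrite (fvalE XP irrX oU Ux hf).
Qed.

Lemma generic_ker_derivation (D : K -> K) k v : cderivation cst D ->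
  generic_ker k.+1 v -> generic_ker k (map_mx D v).
Proof.
move=> hD [U [a [oU U0 ha ->]]]; have [i0 ch0] := chart_ex.
have [N [Q [G [hQ hG G0 DQ]]]] :=
  common_denominator (fun i => D (ev XP irrX i0 'X_i)).
have od := open_dom XP i0 hG.
have d0 := dom_neq0 XP irrX ch0 hG G0.
have [V [oV V0 s1 s2]] := common_open XP irrX oU od U0 d0.
exists V, (Dvec D a); split=> //.
  exact: (Dvec_ker ch0 hD hQ hG DQ oV s2 (ker_sub XP oU oV s1 ha)).
apply/rowP => i; rewrite !mxE -[LHS]germ_fval; congr germ.
by apply/funext => x; rewrite mxE.
Qed.

Section Ranks.
Variable M : nat -> 'M[K]_n.
Hypothesis hM : forall k v, generic_ker k v <-> (v <= M k)%MS.

Lemma Rsheaf_rank k : has_rank X (Rsheaf X k) (\rank (M k)).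
Proof.
have [i0 [x0 ch0]] := chart_ex.
set B := row_base (M k).
have hB j : generic_ker k (row j B) by apply/hM; rewrite -(eq_row_base (M k)) row_sub.
have /choice [U0] := hB; move=> /choice [a hUa].
have [U1 [oU1 U10 s1]] := common_open_fin (fun j => let: And4 o _ _ _ := hUa j in o)
   (fun j => let: And4 _ u _ _ := hUa j in u).
have [U [oU U_0 sU1 sUc]] := common_open XP irrX oU1 (zopen_coord XP i0) U10 (ex_intro _ x0 ch0).
have nU x : U x -> x 0 i0 != 0 by move=> /sUc [_]; rewrite mevalXU.
have ha j : ker_taylor X k U (a j).
  have [o _ h _] := hUa j; apply: (ker_sub XP o oU _ h); exact: subset_trans (s1 j).
have Ba j i : B j i = germ (fun x => a j x 0 i).
  by have [_ _ _ /rowP /(_ i)] := hUa j; rewrite !mxE.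
exists U, (fun j (x : pt) => (x 0 i0)^-1 *: a j x); split=> //.
- by move=> j; apply: ker_Rsheaf.
- move=> U' al oU' U'0 sU' hal rel j x U'x.
  have ha' j' i : sec X 0 U' (fun x => a j' x 0 i).
    by apply: (ker_sec i oU'); apply: (ker_sub XP oU oU' sU' (ha j')).
  have : (\row_j germ (al j)) *m B = 0.
    apply/rowP => i; rewrite !mxE.
    rewrite (eq_bigr (fun j => germ (al j) * germ (fun x => a j x 0 i))); last first.
      by move=> l _; rewrite mxE Ba.
    rewrite -(germ_lincomb _ oU' U'0 hal (fun j => ha' j i)) -[RHS](rmorph0 cst).
    apply: (germ_ext XP irrX oU' U'0).
      by apply: sec_sum => // l; apply: secM0.
    move=> y U'y; have := congr1 (fun v : pt => y 0 i0 * v 0 i) (rel y U'y).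
    rewrite summxE [X in _ = _ * X]mxE mulr0 mulr_sumr => e.
    rewrite -[RHS]e; apply: eq_bigr => l _.
    by rewrite !mxE mulrCA mulVKf // (nU _ (sU' _ U'y)).
  move=> /eqP; rewrite mulmx_free_eq0 ?row_base_free // => /eqP /rowP /(_ j).
  rewrite !mxE -(rmorph0 cst) => e.
  exact: (germ_inj oU' (hal j) (secC XP 0 oU') e U'x).
- move=> U' t oU' U'0 ht; have kt := Rsheaf_ker i0 oU' ht.
  have : generic_ker k (vgerm (fun x : pt => x 0 i0 *: t x)) by exists U', (fun x : pt => x 0 i0 *: t x).
  move=> /hM; rewrite -(eq_row_base (M k)) => /submxP [d hd].
  have /choice [al] : forall j, exists f, rational X f /\ d 0 j = germ f.
    by move=> j; have [f] := germP (d 0 j); exists f.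
  move=> hal; have /choice [Va hVa] : forall j, exists V, [/\ zopen X V, V !=set0 & sec X 0 V (al j)].
    by move=> j; have [[V]] := hal j; exists V.
  have [V1 [oV1 V10 sV1]] := common_open_fin (fun j => let: And3 o _ _ := hVa j in o)
    (fun j => let: And3 _ u _ := hVa j in u).
  have [V2 [oV2 V20 s21 s2U]] := common_open XP irrX oV1 oU V10 U_0.
  have [V [oV V0 sV2 sVU']] := common_open XP irrX oV2 oU' V20 U'0.
  have sVU : V `<=` U by apply: subset_trans s2U.
  have sal j : sec X 0 V (al j).
    have [_ _ h] := hVa j; apply: (sec_sub XP oV _ h).
    exact: (subset_trans sV2 (subset_trans s21 (sV1 j))).
  have saj j i : sec X 0 V (fun x => a j x 0 i).
    by apply: (ker_sec i oV); apply: (ker_sub XP oU oV sVU (ha j)).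
  exists V, al; split=> //; first by move=> x Vx; split; [apply: sVU | apply: sVU'].
  move=> x Vx; apply/rowP => i.
  have e : germ (fun x : pt => (x 0 i0 *: t x) 0 i) = germ (fun x => \sum_j al j x * a j x 0 i).
    rewrite (germ_lincomb _ oV V0 sal (fun j => saj j i)).
    have /rowP /(_ i) := hd; rewrite !mxE => ->; apply: eq_bigr => j _.
    by have [_ ->] := hal j; rewrite -Ba.
  have st : sec X 0 V (fun x : pt => (x 0 i0 *: t x) 0 i).
    by apply: (ker_sec i oV); apply: (ker_sub XP oU' oV sVU' kt).
  have ss : sec X 0 V (fun x => \sum_j al j x * a j x 0 i).
    by apply: sec_sum => // j; apply: secM0.
  have := germ_inj oV st ss e Vx; rewrite mxE => ex.
  have nx := nU x (sVU x Vx).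
  apply: (mulfI nx); rewrite ex summxE mulr_sumr; apply: eq_bigr => j _.
  by rewrite !mxE; field.
Qed.

Lemma generic_ker_anti k l : (k <= l)%N -> (M l <= M k)%MS.
Proof.
move=> /subnKC <-; elim: (l - k)%N => [|d IH]; first by rewrite addn0.
rewrite addnS; apply: submx_trans IH; apply: row_subspaceP (hM _) _ => i.
by apply/generic_kerS/hM/row_sub.
Qed.

Lemma constant_basis k : \rank (M k.+1) = \rank (M k) ->
  exists2 B : 'M[C]_(\rank (M k), n), row_free B & (map_mx cst B :=: M k)%MS.
Proof.
move=> rk; have sub := generic_ker_anti (leqnSn k).
have eM : (M k.+1 :=: M k)%MS.
  by apply/eqmxP; have [_ <-] := mxrank_leqif_eq sub; rewrite rk.
have [f [B [fB eB]]] := normalized_basis (row_base_free (M k)).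
have {}eB : (B :=: M k)%MS by apply: eqmx_trans eB (eq_row_base _).
have DB D : cderivation cst D -> map_mx D B = 0.
  move=> hD; have /submxP [Y hY] : (map_mx D B <= B)%MS.
    rewrite eB; apply: row_subspaceP (hM _) _ => i.
    rewrite -map_row; apply: generic_ker_derivation => //.
    by apply/hM; rewrite eM -eB row_sub.
  suff Y0 : Y = 0 by rewrite hY Y0 mul0mx.
  have : colsub f (map_mx D B) = Y by rewrite hY -mulmx_colsub fB mulmx1.
  have D1 (b : bool) : D b%:R = 0.
    by rewrite -(rmorph_nat cst b); case: hD => h _ _; apply: h.
  move=> <-; apply/matrixP => i j; rewrite !mxE.
  by have /matrixP /(_ i j) := fB; rewrite !mxE => ->.
have cB i j : exists c, B i j = cst c.
  apply: contrapT => nc; have [i0 ch0] := chart_ex.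
  have [D hD /eqP] := derivation_ex ch0 nc; apply.
  by have /matrixP /(_ i j) := DB D hD; rewrite !mxE.
have /choice [g hg] := fun p : 'I__ * 'I_n => cB p.1 p.2.
have eg : map_mx cst (\matrix_(i, j) g (i, j)) = B.
  by apply/matrixP => i j; rewrite !mxE -hg.
exists (\matrix_(i, j) g (i, j)); last by rewrite eg.
by rewrite /row_free -(mxrank_map cst) eg eB.
Qed.

End Ranks.

Section Stable.
Variables (m c : nat) (B : 'M[C]_(c, n)).
Hypothesis freeB : row_free B.
Hypothesis kerB : forall v, generic_ker m v <-> (v <= map_mx cst B)%MS.

Definition spanB : {vspace 'rV[C]_n} := limg (linfun (mulmxr B : 'rV_c -> 'rV_n)).

Lemma spanBP w : reflect (w \in spanB) (w <= B)%MS.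
Proof.
apply: (iffP submxP) => [[u ->]|/memv_imgP [u _ ->]].
  by apply/memv_imgP; exists u; rewrite ?memvf // lfunE.
by exists u; rewrite lfunE.
Qed.

Lemma dim_spanB : \dim spanB = c.
Proof.
rewrite /spanB limg_dim_eq; first by rewrite dimvf /dim /= mul1n.
apply/eqP; rewrite -subv0; apply/subvP => u.
rewrite memv_cap memv_ker lfunE /= => /andP [_].
by rewrite mulmx_free_eq0 // => /eqP ->; rewrite mem0v.
Qed.

Lemma spanB_vanish w x : w \in spanB -> X x -> lform w x = 0.
Proof.
move=> /spanBP hw Xx.
have : generic_ker m (map_mx cst w) by apply/kerB; rewrite map_submx.
move=> [U [a [oU U0 ha /rowP e]]].
have aw y : U y -> a y = w.
  move=> Uy; apply/rowP => i; have := e i; rewrite !mxE => ei.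
  exact: esym (germ_inj oU (secC XP _ oU) (ker_sec i oU ha) ei Uy).
have van y : U y -> lform w y = 0.
  by move=> Uy; rewrite -(aw y Uy); apply: (ker_vanish XP oU ha Uy).
pose F : {mpoly C[n]} := \sum_i w 0 i *: 'X_i.
have hF : F \is 1.-homog by apply: rpred_sum => i _; apply: rpredZ; apply: homogX.
have FE (y : pt) : F.@[y 0] = lform w y.
  by rewrite /F (raddf_sum (meval _)); apply: eq_bigr => i _; rewrite /= mevalZ mevalXU.
apply: contrapT => /eqP nx.
have [|y [[_]]] := zopen_meet irrX (zopen_basic XP hF) oU _ U0.
  by exists x; split=> //; rewrite FE.
by rewrite FE => ny /van ey; rewrite ey eqxx in ny.
Qed.

Lemma generic_ker_spanB k w : w \in spanB -> generic_ker k (map_mx cst w).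
Proof.
move=> hw; have oX := zopenX XP.
exists X, (fun=> w); split=> //; first exact: zopenX0.
  apply: ker_of_vanish => //; first by move=> i; apply: secC.
  by move=> x y _ Xy; apply: spanB_vanish.
by apply/rowP => i; rewrite !mxE.
Qed.

Lemma ker_in_spanB U a x : zopen X U -> ker_taylor X m U a -> U x -> a x \in spanB.
Proof.
move=> oU ha Ux; have U0 : U !=set0 by exists x.
have : generic_ker m (vgerm a) by exists U, a.
move=> /kerB; rewrite submxE -map_cokermx => /eqP /rowP h.
apply/spanBP; rewrite submxE; apply/eqP/rowP => l.
have := h l; rewrite !mxE.
rewrite (eq_bigr (fun i => germ (fun x => a x 0 i) * germ (fun=> cokermx B i l))); last first.
  by move=> i _; rewrite !mxE.
have sa i := ker_sec i oU ha; have sc i := secC XP (cokermx B i l) oU.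
rewrite -(germ_lincomb _ oU U0 sa sc) -[X in _ = X](rmorph0 cst) => e.
have ss : sec X 0 U (fun x => \sum_i a x 0 i * cokermx B i l).
  by apply: sec_sum => // i; apply: secM0.
exact: (germ_inj oU ss (secC XP 0 oU) e Ux).
Qed.

Lemma WO_ker k U : zopen X U -> WO X spanB U `<=` ker_taylor X k U.
Proof.
move=> oU s [N [w [f [hw hf e]]]]; apply: ker_of_vanish => //.
  move=> i; apply: (@sec_ext _ _ _ _ _ (fun x => \sum_j f j x * w j 0 i)).
    by move=> x Ux; rewrite e // summxE; apply: eq_bigr => j _; rewrite mxE.
  by apply: sec_sum => // j; apply: secM0 => //; apply: secC.
move=> x y Ux Xy; apply: spanB_vanish => //; rewrite e //.
by apply: memv_suml => j _; apply: memvZ.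
Qed.

Lemma ker_WO U : zopen X U -> ker_taylor X m U `<=` WO X spanB U.
Proof.
move=> oU a ha.
exists c, (fun j => row j B), (fun j x => \sum_i a x 0 i * pinvmx B i j); split.
- by move=> j; apply/spanBP; apply: row_sub.
- move=> j; apply: sec_sum => // i; apply: secM0 => //; last exact: secC.
  exact: ker_sec ha.
- move=> x Ux; have /spanBP h := ker_in_spanB oU ha Ux.
  rewrite -{1}(mulmxKpV h) mulmx_sum_row; apply: eq_bigr => j _.
  by rewrite mxE.
Qed.

End Stable.

End Main.

Lemma nonincreasing_stationary (c : nat -> nat) : (forall k, (c k.+1 <= c k)%N) ->
  exists m, [/\ (1 <= m)%N, c m.+1 = c m &
    forall i, (1 <= i < m)%N -> (c i.+1 < c i)%N].
Proof.
move=> dec.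
have ex : exists m, (1 <= m)%N && (c m.+1 == c m).
  apply: contrapT => nex.
  have h k : (c k.+1 + k <= c 1)%N.
    elim: k => [|k IH]; first by rewrite addn0.
    have : c k.+2 != c k.+1 by apply/negP => e; apply: nex; exists k.+1.
    have := dec k.+1; lia.
  have := h (c 1%N).+1; lia.
case: (ex_minnP ex) => m /andP [m1 /eqP e] minm; exists m; split=> // i /andP [i1 im].
rewrite ltn_neqAle dec andbT; apply/negP => ei.
by have := minm i; rewrite i1 ei => /(_ isT); rewrite leqNgt im.
Qed.

Theorem proposition2p6 (R : realType) (r n : nat) (X : set 'rV[R[i]]_r.+1)
    (hX : qproj_variety X) (hdim : has_dim X n) (hn : (1 <= n)%N) :
  exists c : nat -> nat,
    (forall k, has_rank X (Rsheaf X k) (c k)) /\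
    exists m : nat,
      [/\ (1 <= m)%N,
          forall i, (1 <= i < m)%N -> (c i.+1 < c i)%N,
          forall i, (m <= i)%N -> c i = c m &
          [/\ c m = 0%N,
              zero_sheaf X (Rsheaf X m) &
              forall W : {vspace 'rV[R[i]]_r.+1},
                linspace W `<` Pr -> ~ X `<=` linspace W]
          \/
          exists W : {vspace 'rV[R[i]]_r.+1},
            [/\ \dim W = c m,
                forall U, zopen X U -> twist X (Rsheaf X m) 1 U = WO X W U,
                forall i U, zopen X U ->
                  twist X (Rsheaf X m) 1 U `<=` twist X (Rsheaf X i) 1 U &
                X `<=` linspace W]].
Proof.
case: hX => [[A [B [[S _ ->] _ XE]]] irrX].
have XP : X `<=` Pr by rewrite XE => x [[]].
have /choice [M hM] := @generic_ker_subspace R r X XP irrX.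
exists (fun k => \rank (M k)); split; first exact: Rsheaf_rank hM.
have dec k : (\rank (M k.+1) <= \rank (M k))%N.
  exact: mxrankS (generic_ker_anti hM (leqnSn k)).
have [m [m1 em sm]] := nonincreasing_stationary dec.
have [B0 freeB eB] := constant_basis hM em.
have kerB v : @generic_ker R r X XP irrX m v <-> (v <= map_mx (cst XP irrX) B0)%MS by rewrite hM eB.
exists m; split=> //.
  move=> i mi; apply/eqP; rewrite eqn_leq; apply/andP; split.
    exact: mxrankS (generic_ker_anti hM mi).
  apply: mxrankS; rewrite -eB; apply: row_subspaceP (hM i) _ => j.
  rewrite -map_row; apply: (generic_ker_spanB kerB).
  by apply/spanBP; apply: row_sub.
right; exists (spanB B0).
have twE k U s oU := @twist_RsheafE R r X XP k U s oU.
have eW U : zopen X U -> twist X (Rsheaf X m) 1 U = WO X (spanB B0) U.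
  move=> oU; apply/seteqP; split=> s.
    by move=> /twE -/(_ oU); apply: (ker_WO kerB oU).
  by move=> hs; apply/(twE _ _ _ oU); apply: (WO_ker kerB) hs.
split=> //.
- exact: dim_spanB.
- by move=> i U oU; rewrite eW // => s hs; apply/(twE _ _ _ oU); apply: (WO_ker kerB) hs.
- by move=> x Xx; split; [exact: (XP x Xx) | move=> w hw; apply: (spanB_vanish kerB hw)].
Qed.
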